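(* Let $(G_N)_{N\ge1}$ be a sequence of finite groups with $|G_N|\to\infty$. Assume that the sequence of measures $\widetilde{\mu}_{G_N}$ converges weakly to the Dirac mass at $\infty$. Let $\xi$ be a complex random variable such that $\mathbb{E}\xi=\mathbb{E}\xi^2=0$, $\mathbb{E}|\xi|^2=1$ and $\xi$ has finite moments of all orders. Let $m$ be a positive integer and, for each $N$, let $X^{N,1}=(X^{N,1}_g)_{g\in G_N},\ldots,X^{N,m}=(X^{N,m}_g)_{g\in G_N}$ be independent families of independent copies of $\xi$. Then, as $N\to\infty$, the family of random matrices $$\big(|G_N|^{-1/2}P_{X^{N,1}},\,|G_N|^{-1/2}P_{X^{N,1}}^\ast,\,\ldots,\,|G_N|^{-1/2}P_{X^{N,m}},\,|G_N|^{-1/2}P_{X^{N,m}}^\ast\big)$$ converges in moments to the family $(c_1,c_1^\ast,\ldots,c_m,c_m^\ast)$, where $c_1,\ldots,c_m$ are circular elements (of some $C^\ast$-probability space) such that $\{c_1,c_1^\ast\},\ldots,\{c_m,c_m^\ast\}$ are free.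
   Context: For a finite group $G$ and $X\colon G\to\mathbb{C}$ (also written $X=(X_g)_{g\in G}$), $P_X\colon\mathbb{C}^G\to\mathbb{C}^G$ is the convolution operator $(P_Xv)(h)=\sum_{g\in G}X(hg^{-1})v(g)$, identified with the matrix $[X(hg^{-1})]_{h,g\in G}$; $P_X^\ast$ is its conjugate transpose. $\mathbb{Z}_+=\{1,2,\ldots\}$ and $\overline{\mathbb{Z}}_+=\mathbb{Z}_+\cup\{\infty\}$ is its one-point compactification. $\widehat{G}$ is the set of equivalence classes of irreducible unitary representations of $G$. $\widetilde{\mu}_G$ is the probability measure on $\overline{\mathbb{Z}}_+$ given by $\widetilde{\mu}_G(\{n\})=\frac{n^2}{|G|}|\{\Lambda\in\widehat G\colon\dim\Lambda=n\}|$ for $n\in\mathbb{Z}_+$ (the image under $\Lambda\mapsto\dim\Lambda$ of the Plancherel measure $\mu_G(\Lambda)=(\dim\Lambda)^2/|G|$). A $C^\ast$-probability space is a pair $(\mathcal{A},\varphi)$ with $\mathcal{A}$ a unital $C^\ast$-algebra and $\varphi$ a state on $\mathcal{A}$. A self-adjoint element $a\in\mathcal{A}$ is semicircular if $\varphi(a^n)=0$ for $n$ odd and $\varphi(a^{2k})=\frac{1}{k+1}\binom{2k}{k}$ for $k\in\mathbb{N}$. Unital subalgebras $\mathcal{A}_1,\ldots,\mathcal{A}_m$ are free if for every $n$, every sequence $i_1,\ldots,i_n\in\{1,\ldots,m\}$ with $i_k\ne i_{k+1}$ for $k=1,\ldots,n-1$, and all $a_k\in\mathcal{A}_{i_k}$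 with $\varphi(a_k)=0$, one has $\varphi(a_1\cdots a_n)=0$. A family of subsets of $\mathcal{A}$ is free if the unital subalgebras they generate are free. An element $c\in\mathcal{A}$ is circular if $c=(a+\sqrt{-1}\,b)/\sqrt2$ for two free semicircular elements $a,b$. Random $n\times n$ matrices are treated as elements of the noncommutative probability space $(\mathcal{M}_n,\frac1n\mathbb{E}\,\mathrm{tr})$, where $\mathcal{M}_n$ is the set of random variables with values in complex $n\times n$ matrices (here $n=|G_N|$). Tuples $A_N=(a_1^N,\ldots,a_r^N)$ in $(\mathcal{A}_N,\varphi_N)$ converge in moments to a tuple $A=(a_1,\ldots,a_r)$ in $(\mathcal{A},\varphi)$ if $\lim_{N\to\infty}\varphi_N(Q(A_N))=\varphi(Q(A))$ for every noncommutative polynomial $Q$ in $r$ variables. *)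

(* Defs.v *)
From HB Require Import structures.
From mathcomp Require Import all_boot all_order all_algebra all_fingroup.
From mathcomp Require Import finmap mxrepresentation spectral complex.
From mathcomp Require Import all_classical all_reals all_analysis.
From mathcomp Require Import -(notations) monalg.

Set Implicit Arguments.
Unset Strict Implicit.
Unset Printing Implicit Defensive.

Import Order.TTheory GRing.Theory Num.Theory.
Import numFieldNormedType.Exports.

Local Open Scope classical_set_scope.
Local Open Scope ring_scope.

(* The norm is a mixin field, and not the one of CompleteNormedModule, because
   the library admits no common extension of its normed modules and of its
   noncommutative algebras: rings with a norm are instances of numDomainType. *)
HB.mixin Record isCStarAlgebra (R : realType) A of GRing.Algebra R[i] A := {
  star : A -> A ;
  cnorm : A -> R ;
  cnorm_eq0 : forall x, cnorm x = 0 -> x = 0 ;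
  cnormD_le : forall x y, cnorm (x + y) <= cnorm x + cnorm y ;
  cnormZ : forall (k : R[i]) x, cnorm (k *: x) = Normc.normc k * cnorm x ;
  cnormM_le : forall x y, cnorm (x * y) <= cnorm x * cnorm y ;
  cnorm_complete : forall u : nat -> A,
    (forall e : R, 0 < e -> exists N : nat, forall m n : nat,
       (N <= m)%N -> (N <= n)%N -> cnorm (u m - u n) < e) ->
    exists l : A, (fun n => cnorm (u n - l)) @ \oo --> (0 : R) ;
  starK : involutive star ;
  starD : forall x y, star (x + y) = star x + star y ;
  starZ : forall (k : R[i]) x, star (k *: x) = k^* *: star x ;
  starM : forall x y, star (x * y) = star y * star x ;
  cnorm_star : forall x, cnorm (star x * x) = cnorm x ^+ 2
}.

#[short(type="cstarAlgType")]
HB.structure Definition CStarAlgebra (R : realType) :=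
  { A of isCStarAlgebra R A & GRing.Algebra R[i] A }.

Arguments star {R s} x.

Section Freeness.
Variables (R : realType) (A : cstarAlgType R).
Implicit Types (phi : {scalar A}) (a b c : A).

Definition is_state phi :=
  phi 1 = 1 /\ forall x : A, 0 <= phi (star x * x).

Definition unital_subalg (B : set A) :=
  [/\ B 1, (forall (k : R[i]) x y, B x -> B y -> B (k *: x + y))
    & forall x y, B x -> B y -> B (x * y)].

Definition gen_subalg (E : set A) : set A := smallest unital_subalg E.

Definition free_subalgs (I : Type) phi (B : I -> set A) :=
  forall (n : nat) (i : 'I_n.+1 -> I) (x : 'I_n.+1 -> A),
    (forall k l : 'I_n.+1, (k.+1 = l)%N -> i k <> i l) ->
    (forall k, B (i k) (x k)) -> (forall k, phi (x k) = 0) ->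
    phi (\prod_(k < n.+1) x k) = 0.

Definition free_sets (I : Type) phi (E : I -> set A) :=
  free_subalgs phi (fun i => gen_subalg (E i)).

Definition semicircular phi a :=
  [/\ star a = a, (forall n, odd n -> phi (a ^+ n) = 0)
    & forall k, phi (a ^+ (2 * k)) = (k.+1)%:R^-1 * 'C(2 * k, k)%:R].

Definition circular phi c := exists a b : A,
  [/\ semicircular phi a, semicircular phi b,
      free_sets phi (fun t : bool => [set if t then b else a])
    & c = (sqrtC 2)^-1 *: (a + 'i *: b)].

End Freeness.

Section MomentConvergence.
Variables (R : realType) (I : choiceType).

(* Noncommutative polynomials in the variables I: the algebra of the free
   monoid over I. *)
Definition ncpoly := malg (fmonom I) R[i].

(* [iota] is the scalar embedding of R[i] into S. It is a parameter because
   n x n matrices are an instance of algType only for n of the form n'.+1. *)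
Definition nceval (S : pzRingType) (iota : R[i] -> S) (x : I -> S)
    (Q : ncpoly) : S :=
  \sum_(w <- msupp Q) iota (mcoeff w Q) * \prod_(k <- w) x k.

Definition cvg_in_moments
    (S : nat -> pzRingType) (iota : forall N, R[i] -> S N)
    (phi : forall N, S N -> R[i]) (x : forall N, I -> S N)
    (A : algType R[i]) (psi : A -> R[i]) (a : I -> A) :=
  forall Q : ncpoly,
    (fun N => phi N (nceval (iota N) (x N) Q)) @ \oo
      --> (psi (nceval (in_alg A) a Q) : R[i]^o).

End MomentConvergence.

Section ComplexRandomVariables.
Context d (T : measurableType d) (R : realType) (P : probability T R).
Implicit Types X : T -> R[i].

(* The Borel structure of R[i] is transported from that of R * R. *)
Definition RIm (z : R[i]) : R * R := (complex.Re z, complex.Im z).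

Definition complex_rv X := measurable_fun [set: T] (RIm \o X).

Definition cexp X : R[i] :=
  (Rintegral P [set: T] (fun w => complex.Re (X w)) +i*
   Rintegral P [set: T] (fun w => complex.Im (X w)))%C.

Definition abs_moment X (k : nat) : \bar R :=
  (\int[P]_w (complex.Re `|X w| ^+ k)%:E)%E.

Definition mutually_independent (I : finType) (X : I -> T -> R[i]) :=
  forall (J : {set I}) (B : I -> set (R * R)),
    (forall i, measurable (B i)) ->
    P (\bigcap_(i in [set` J]) (RIm \o X i) @^-1` B i) =
    (\prod_(i in J) P ((RIm \o X i) @^-1` B i))%E.

End ComplexRandomVariables.

Definition same_law d d' (T : measurableType d) (T' : measurableType d')
    (R : realType) (P : probability T R) (P' : probability T' R)
    (X : T -> R[i]) (X' : T' -> R[i]) :=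
  forall B : set (R * R), measurable B ->
    P ((@RIm R \o X) @^-1` B) = P' ((@RIm R \o X') @^-1` B).

Definition random_mx (R : realType) (T : Type) (n : nat) : pzRingType :=
  T -> 'M[R[i]]_n.

Definition random_scalar_mx (R : realType) (T : Type) (n : nat) (k : R[i]) :
  random_mx R T n := fun=> k%:M.

Definition Etr d (T : measurableType d) (R : realType) (P : probability T R)
    (n : nat) (M : random_mx R T n) : R[i] :=
  n%:R^-1 * cexp P (fun w => \tr (M w)).

Definition conv_mx (R : realType) (gT : finGroupType) (X : gT -> R[i]) :
    'M[R[i]]_#|gT| :=
  \matrix_(h, g) X (enum_val h * (enum_val g)^-1)%g.

Section UnitaryDual.
Variables (R : realType) (gT : finGroupType).

Definition irr_unitary_repr (n : nat) :
    set (mx_representation R[i] [set: gT]%G n) :=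
  [set rho | mx_irreducible rho /\ forall g, rho g \is unitarymx].

Definition unitary_dual (n : nat) :
    set (set (mx_representation R[i] [set: gT]%G n)) :=
  [set K | exists2 rho, @irr_unitary_repr n rho &
     K = [set rho' | irr_unitary_repr rho' /\ mx_rsim rho rho']].

(* [fset_set] would be empty on an infinite set, but a finite group has finitely
   many classes of irreducible representations. *)
Definition num_irr (n : nat) : nat := #|` fset_set (@unitary_dual n)|.

End UnitaryDual.

(* Z_+ carries the (discrete) topology induced by that of nat. *)
Definition Zpos := set_type [set n : nat | (0 < n)%N].

Definition Zpos_succ (n : nat) : Zpos :=
  SigSub (mem_set (ltn0Sn n : [set k : nat | (0 < k)%N] n.+1)).

Definition Zbar := one_point_compactification Zpos.

Definition Borel (X : ptopologicalType) := g_sigma_algebraType (@open X).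

Section PlancherelDimension.
Variables (R : realType) (gT : finGroupType).

Definition plancherel_weight (n : nat) : {nonneg R} :=
  ((n ^ 2)%:R / #|gT|%:R * (num_irr R gT n)%:R)%:nng.

Definition plancherel_dim : {measure set (Borel Zbar) -> \bar R} :=
  mseries (fun n => mscale (plancherel_weight n.+1)
                           (dirac (Some (Zpos_succ n) : Borel Zbar))) 0.

Lemma plancherel_dim1 (n : nat) :
  plancherel_dim [set Some (Zpos_succ n) : Borel Zbar] =
  ((n.+1 ^ 2)%:R / #|gT|%:R * (num_irr R gT n.+1)%:R)%:E.
Proof.
rewrite /plancherel_dim /= /mseries (nneseries_split 0 n.+1); last first.
  by move=> k _; rewrite measure_ge0.
rewrite add0n big_mkord big_ord_recr /= big1 ?add0e; last first.
  move=> i _; rewrite /mscale /= diracE memNset ?mule0 //= => -[]/eqP.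
  by rewrite ?(ltn_eqF (ltn_ord i)) ?(gtn_eqF (ltn_ord i)).
rewrite eseries0; last first.
  move=> k nk _; rewrite /mscale /= diracE memNset ?mule0 //= => -[]/eqP.
  by rewrite ?(ltn_eqF nk) ?(gtn_eqF nk).
by rewrite adde0 /mscale /= diracE mem_set //= mule1.
Qed.

End PlancherelDimension.

Definition weak_cvg (R : realType) (X : ptopologicalType)
    (mu : nat -> {measure set (Borel X) -> \bar R})
    (nu : {measure set (Borel X) -> \bar R}) :=
  forall f : X -> R, continuous f -> bounded_fun f ->
    (fun N => Rintegral (mu N) [set: Borel X] f) @ \oo
      --> Rintegral nu [set: Borel X] f.

(* Main.v *)
Require Import Defs.
From HB Require Import structures.
From mathcomp Require Import all_boot all_order all_algebra all_fingroup.
From mathcomp Require Import finmap mxrepresentation spectral complex.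
From mathcomp Require Import all_classical all_reals all_analysis.
From mathcomp Require Import -(notations) monalg.
From mathcomp Require Import ring lra zify measurable_realfun.

(** Write r for the square root of the order of G. Expanding the trace of a word
    of n factors gives r^-n times the sum, over the labellings of the n
    positions by group elements whose product is 1, of the expectation of a
    product of n independent copies of xi and their conjugates
    ([prod_conv_mx], [cexp_word]). This expectation vanishes when some variable
    occurs only once. Labellings where every variable occurs at least twice, and
    one of them three times, are fewer than r^n by a factor r
    ([card_bad_labels]). For the others the expectation is a sum over the
    pairings of the positions, as if xi were Gaussian ([mixed_moment_wick]): it
    sees only the two second moments of xi, and a pairing must match each factor
    with an adjoint of the same index whose label is the inverse.

    So it remains to count, for a given pairing, the labellings by mutually
    inverse labels whose product is 1, out of r^n. If the pairing is
    noncrossing, the labels cancel and all labellings count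
    ([noncrossing_product]). If two pairs cross, multiply the labels of one by x
    and x^-1 and those of the other by z and z^-1. This permutes the labellings
    compatible with the pairing, and the product becomes a word
    p1 x p2 z p3 x^-1 p4 z^-1 p5. For given p's it is 1 for at most as many
    (x, z) as there are commuting pairs in G ([commutator_word_count]).
    Hence a crossing pairing contributes at most the proportion of commuting
    pairs ([crossing_pairing_bound]). By Burnside this proportion is the number
    of conjugacy classes over the order of G; this is also the number of
    irreducible representations over the order, and therefore the integral of
    1/n^2 against the measure of the dimensions ([integral_inv_square]). The
    function 1/n^2 is continuous on the compactification and vanishes at
    infinity, so the assumed weak convergence makes the proportion tend to 0
    ([commuting_pairs_vanish]).

    The limit of the moment is thus the number of noncrossing pairings that match
    every letter with an adjoint of the same index, and the free circular family
    has the same moments. Reading a word from left to right with the stack of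
    the positions still open, a pairing is noncrossing when each closing letter
    closes the top of the stack; this gives the recursion [fock]. In the
    algebra, the Wick polynomials [wick] indexed by stacks obey the same
    recursion, and moments are given by [fock] exactly when the state vanishes
    on the polynomials of nonempty stacks ([wick_moment],
    [moment_wick_centered]). That property is tailored to freeness: a Wick
    polynomial is the product of those of its maximal runs of one colour, so it
    passes from free subalgebras to the algebra they generate
    ([free_wick_centered]). It is also stable under linear changes of letters
    ([linear_wick_centered]). For one semicircular element it amounts to the
    Catalan numbers; two free ones give a circular element and its adjoint, and
    freeness again gives the whole family ([free_circular_moment]). *)

Set Implicit Arguments.
Unset Strict Implicit.
Unset Printing Implicit Defensive.

Import Order.TTheory GRing.Theory Num.Theory.
Import numFieldNormedType.Exports.

Local Open Scope classical_set_scope.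
Local Open Scope sesquilinear_scope.
Local Open Scope ring_scope.

(** * Wick polynomials and the moments they determine *)

Section WickPolynomials.
Variables (F : fieldType) (A : algType F) (phi : {scalar A}).

(** Sum over the noncrossing pairings of [w], read from left to right with the
    stack [st] of the letters still open: a letter is either opened, or closes
    the top of the stack. Equivalently, a vacuum expectation on the full Fock
    space, each letter being a creation plus an annihilation operator. *)
Fixpoint fock (T : Type) (K : T -> T -> F) (w st : seq T) : F :=
  if w is l :: w' then
    fock K w' (l :: st)
      + (if st is y :: st' then K y l * fock K w' st' else 0)
  else (nilp st)%:R.

(** The noncommutative orthogonal polynomials attached to the covariance [K]:
    multiplication by a letter acts on them as creation plus annihilation, as
    in [fock]. For one letter and [K = 1] they are the Chebyshev polynomials
    of the second kind. *)
Fixpoint wick (T : Type) (K : T -> T -> F) (x : T -> A) (st : seq T) : A :=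
  if st is l :: st' then
    wick K x st' * x l
      - (if st' is y :: st'' then K y l *: wick K x st'' else 0)
  else 1.

Definition wick_centered (T : Type) (K : T -> T -> F) (x : T -> A) :=
  forall l st, phi (wick K x (l :: st)) = 0.

Lemma wickM (T : Type) (K : T -> T -> F) (x : T -> A) l st :
  wick K x st * x l =
  wick K x (l :: st)
    + (if st is y :: st' then K y l *: wick K x st' else 0).
Proof. by rewrite /= addrNK. Qed.

Lemma wick_map (T T' : Type) (f : T' -> T) (K : T -> T -> F) x st :
  wick K x (map f st) = wick (fun u v => K (f u) (f v)) (x \o f) st.
Proof.
elim: {st}(size st) {-2}st (leqnn (size st)) => [|n IH] [|l [|y st]] //= sz.
have := IH (y :: st) sz => /= ->.
by rewrite IH // ltnW.
Qed.

(** Expanding a monomial on the Wick polynomials follows the recursion of [fock],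
    and [phi] keeps only the polynomial of the empty stack. *)
Lemma wick_moment (T : Type) (K : T -> T -> F) (x : T -> A) :
  phi 1 = 1 -> wick_centered K x ->
  forall w st, phi (wick K x st * \prod_(l <- w) x l) = fock K w st.
Proof.
move=> phi1 wc; elim=> [|l w IH] st.
  by rewrite big_nil mulr1; case: st => [|l st] /=; [|exact: (wc l st)].
rewrite big_cons mulrA wickM mulrDl linearD IH /=; congr (_ + _).
case: st => [|y st]; first by rewrite mul0r linear0.
by rewrite -scalerAl linearZ IH.
Qed.

(** Conversely the moments determine [phi] on the Wick polynomials, which are
    combinations of monomials; together with [wick_moment] this turns a
    formula for moments into a centering property, which is the form in which
    freeness can be used. *)
Lemma moment_wick_centered (T : Type) (K : T -> T -> F) (x : T -> A) :
  (forall w, phi (\prod_(l <- w) x l) = fock K w [::]) -> wick_centered K x.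
Proof.
move=> mom l st.
have main n s w : (size s <= n)%N ->
    phi (wick K x s * \prod_(l <- w) x l) = fock K w s.
  elim: n s w => [|n IH] [|y s] w //= sz; rewrite ?mul1r ?mom //.
  rewrite mulrBl linearB -mulrA.
  have := IH s (y :: w) sz; rewrite big_cons /= => ->.
  case: s sz => [|z s] /= sz; first by rewrite mul0r linear0 subr0 addr0.
  by rewrite -scalerAl linearZ /= IH ?addrK // ltnW.
by have := main _ (l :: st) [::] (leqnn _); rewrite big_nil mulr1.
Qed.

End WickPolynomials.

(** * Moments of a semicircular element *)

Section BallotNumbers.
Variable F : fieldType.

(** Ballot numbers: by the reflection principle the paths from height
    [size st] to 0 that stay nonnegative are all the paths, minus those that
    end at -2. *)
Lemma fock_ballot (w st : seq unit) :
  fock (fun _ _ => 1 : F) w st =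
  if odd (size w + size st) then 0 else
    'C(size w, (size w + size st)./2)%:R - 'C(size w, (size w + size st)./2.+1)%:R.
Proof.
elim: w st => [|l w IH] st /=.
  case: st => [|y st]; first by rewrite subr0.
  by case: st => [|z st] //=; rewrite !bin0n subrr; case: ifP.
rewrite IH /= addnS /=; case: ifP => odd_wst.
  case: st odd_wst => [|y st] odd_wst; first by rewrite addr0.
  rewrite mul1r IH /= addnS /= negbK in odd_wst *.
  by rewrite odd_wst addr0.
case: st odd_wst => [|y st] /= odd_wst.
  rewrite addr0; move: odd_wst; rewrite !addn0 => /negbFE odd_w.
  have [k half_w] : exists k, uphalf (size w) = k.+1.
    by case: (size w) odd_w => // n _; exists n./2.
  (* At height 0 only the step up is allowed; the term for the step down is
     restored by the symmetry of the binomial coefficients. *)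
  have sym_w : 'C(size w, k.+1) = 'C(size w, k).
    rewrite -bin_sub; last by rewrite -half_w uphalf_half odd_w; lia.
    congr 'C(_, _); have := odd_double_half (size w).
    by move: half_w; rewrite uphalf_half odd_w; lia.
  by rewrite half_w !binS !natrD sym_w; ring.
move: odd_wst; rewrite addnS /= negbK mul1r IH => ->.
rewrite !binS !natrD.
ring.
Qed.

Lemma fock_catalan (char0 : [pchar F] =i pred0) (w : seq unit) k :
  size w = (2 * k)%N ->
  fock (fun _ _ => 1 : F) w [::] = (k.+1)%:R^-1 * 'C(2 * k, k)%:R.
Proof.
move=> sw; rewrite fock_ballot sw addn0 mul2n odd_double doubleK.
have k1 : k.+1%:R != 0 :> F by rewrite pcharf0P // in char0; rewrite char0.
apply: (mulfI k1); rewrite mulrA mulfV // mul1r mulrBr -!natrM.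
rewrite mul_bin_left -addnn addKn mulSn natrD natrM.
by rewrite addrK.
Qed.

End BallotNumbers.

(** * Free families and circular elements *)

Section FreeWick.
Variables (R : realType) (A : cstarAlgType R) (phi : {scalar A}).

Lemma unital_subalgZ (B : set A) k x : unital_subalg B -> B x -> B (k *: x).
Proof.
move=> [B1 BZD BM] Bx; have B0 : B 0 by have := BZD (-1) _ _ B1 B1; rewrite scaleN1r addNr.
by rewrite -[_ *: _]addr0; exact: BZD.
Qed.

Lemma unital_subalgD (B : set A) x y : unital_subalg B -> B x -> B y -> B (x + y).
Proof. by move=> [_ BZD _] Bx By; have := BZD 1 _ _ Bx By; rewrite scale1r. Qed.

Lemma gen_subalgP (E : set A) : unital_subalg (gen_subalg E).
Proof.
split=> [|k x y Ex Ey|x y Ex Ey] B BE; have [[B1 BZD BM] _] := BE => //.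
  by apply: BZD; [exact: (Ex B)|exact: (Ey B)].
by apply: BM; [exact: (Ex B)|exact: (Ey B)].
Qed.

Lemma sub_gen_subalg (E : set A) : E `<=` gen_subalg E.
Proof. by move=> x Ex B [_ EB]; exact: EB. Qed.

(** Membership is what allows freeness to be applied to Wick polynomials. *)
Lemma wick_subalg (T : Type) (K : T -> T -> R[i]) (x : T -> A) (B : set A) :
  unital_subalg B -> forall s, (forall l, List.In l s -> B (x l)) -> B (wick K x s).
Proof.
move=> aB s; have [B1 _ BM] := aB.
elim: {s}(size s) {-2}s (leqnn (size s)) => [|n IH] [|l s] //= sz Bs.
have Bs' : B (wick K x s) by apply: IH => // k ks; apply: Bs; right.
have Bl : B (x l) by apply: Bs; left.
rewrite addrC; apply: unital_subalgD => //; last exact: BM.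
case: s sz Bs {Bs'} => [|y s] sz Bs.
  by rewrite oppr0 -[0](scale0r 1); apply: unital_subalgZ.
rewrite -scaleNr; apply: unital_subalgZ => //; apply: IH; first exact: ltnW.
by move=> k ks; apply: Bs; right; right.
Qed.

Section Colours.
Variables (I : eqType) (T : Type) (col : T -> I) (K : T -> T -> R[i]).
Variables (x : T -> A) (B : I -> set A).
Hypothesis phi1 : phi 1 = 1.
Hypothesis B_alg : forall i, unital_subalg (B i).
Hypothesis xB : forall l, B (col l) (x l).
Hypothesis K_col : forall y l, col y != col l -> K y l = 0.
Hypothesis mono : forall l st, all (fun y => col y == col l) st ->
  phi (wick K x (l :: st)) = 0.

(** There is no covariance between distinct colours, so the recursion never
    reaches across the boundary of two runs: the Wick polynomial factors. *)
Lemma wick_cat i u v : all (fun y => col y == i) u ->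
  (if v is y :: _ then col y != i else true) ->
  wick K x (u ++ v) = wick K x v * wick K x u.
Proof.
move=> + v_i.
elim: {u}(size u) {-2}u (leqnn (size u)) => [|n IH] [|l u] //= sz; rewrite ?mulr1 //.
move=> /andP[/eqP li ui]; rewrite IH // mulrBr mulrA; congr (_ - _).
case: u sz ui => [|y u] sz /= ui.
  by case: v v_i {IH} => [|z v] zi; rewrite mulr0 // K_col ?scale0r // li.
by case/andP: ui => _ ui; rewrite IH ?scalerAr // ltnW.
Qed.

(** Cutting a stack into maximal runs of one colour gives factors that are
    centered and alternate between the subalgebras, exactly the products that
    freeness controls. *)
Lemma wick_runs st : exists s : seq (I * A),
  [/\ sorted (fun p q => p.1 != q.1) s,
      forall p, p \in s -> B p.1 p.2 /\ phi p.2 = 0,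
      wick K x st = \prod_(p <- s) p.2
    & if st is l :: _ then exists s' a, s = rcons s' (col l, a) else s = [::]].
Proof.
elim: {st}(size st) {-2}st (leqnn (size st)) => [|n IH] [|l st] //= sz.
- by exists [::]; rewrite big_nil.
- by exists [::]; rewrite big_nil.
have [u [v [def_st u_l v_l]]] : exists u v, [/\ st = u ++ v,
    all (fun y => col y == col l) u
    & if v is y :: _ then col y != col l else true].
  elim: (st) => [|y t [u [v [-> u_l v_l]]]]; first by exists [::], [::].
  have [yl|yl] := boolP (col y == col l); last by exists [::], (y :: u ++ v).
  by exists (y :: u), v; rewrite /= yl.
have [|s [s_alt s_B s_prod s_last]] := IH v.
  by rewrite def_st size_cat ltnS in sz; apply: leq_trans sz; rewrite leq_addl.
exists (rcons s (col l, wick K x (l :: u))); split.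
- case: v v_l s_last {s_prod def_st} => [|y v] y_l; first by move=> ->.
  move=> [s' [a def_s]]; move: s_alt; rewrite {1 2}def_s; case: {s_B def_s} s' => [|p s'] /=.
    by rewrite y_l.
  by move=> s'_alt; rewrite rcons_path s'_alt last_rcons /= y_l.
- move=> p; rewrite mem_rcons inE => /orP[/eqP ->|/s_B //]; split=> /=; last exact: mono.
  apply: (@wick_subalg _ K x _ (B_alg (col l)) (l :: u)) => //= k [<- //|].
  elim: (u) u_l => //= y t IHt /andP[/eqP yl tl] [<-|]; last exact: IHt.
  by rewrite -yl.
- rewrite big_rcons /= -s_prod -/(wick K x (l :: st)) def_st -cat_cons.
  by rewrite (wick_cat (i := col l)) //= ?eqxx //; case: (v) v_l.
- by exists s, (wick K x (l :: u)).
Qed.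

(** Free families have no mixed correlations beyond those of each colour: Wick
    polynomials of several colours are alternating products of centered
    elements. *)
Lemma free_wick_centered : free_subalgs phi B -> wick_centered phi K x.
Proof.
move=> freeB l st; have [s [s_alt s_B -> [s' [a def_s]]]] := wick_runs (l :: st).
have szs : size s = (size s').+1 by rewrite def_s size_rcons.
pose p0 := (col l, a).
rewrite (big_nth p0) big_mkord szs.
apply: (freeB _ (fun k : 'I_(size s').+1 => (nth p0 s k).1)) => [k k' kk'|k|k].
- apply/eqP; rewrite -kk'; apply: (sortedP p0 s_alt).
  by rewrite szs kk'.
- by case: (s_B (nth p0 s k)) => //; rewrite mem_nth // szs.
- by case: (s_B (nth p0 s k)) => //; rewrite mem_nth // szs.
Qed.

End Colours.
End FreeWick.

Section Circular.
Variables (R : realType) (A : cstarAlgType R) (phi : {scalar A}).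
Hypothesis phi1 : phi 1 = 1.

(** The Catalan numbers count the noncrossing pairings of one letter. *)
Lemma semicircular_wick (a : A) : semicircular phi a ->
  wick_centered phi (fun _ _ : unit => 1) (fun _ => a).
Proof.
move=> [_ a_odd a_even]; apply: moment_wick_centered => w.
have -> : \prod_(l <- w) a = a ^+ size w.
  by elim: w => [|u w IH]; rewrite ?big_nil // big_cons IH -exprS.
have [odd_w|even_w] := boolP (odd (size w)).
  by rewrite a_odd // fock_ballot addn0 odd_w.
have sw : size w = (2 * (size w)./2)%N by rewrite mul2n even_halfK.
by rewrite [in LHS]sw a_even (fock_catalan (@pchar_num _) sw).
Qed.

Lemma free_semicircular_wick (a b : A) :
  semicircular phi a -> semicircular phi b ->
  free_sets phi (fun t : bool => [set if t then b else a]) ->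
  wick_centered phi (fun s t : bool => (s == t)%:R) (fun t => if t then b else a).
Proof.
move=> sa sb; apply: (@free_wick_centered _ _ _ _ _ id) => //.
- by move=> i; exact: gen_subalgP.
- by move=> t; apply: sub_gen_subalg.
- by move=> s t /= /negbTE ->.
move=> t st st_t.
have -> : t :: st = map (fun _ : unit => t) (nseq (size st).+1 tt).
  rewrite map_nseq /=; congr (_ :: _); apply/all_pred1P.
  by apply: sub_all st_t => y /=.
rewrite wick_map /= eqxx.
by case: t {st_t}; [have := semicircular_wick sb|have := semicircular_wick sa]; apply.
Qed.

Section LinearChange.
Variables (a b : A).
Let x (v : R[i] * R[i]) := v.1 *: a + v.2 *: b.
Let K (u v : R[i] * R[i]) := u.1 * v.1 + u.2 * v.2.
Let e (t : bool) : R[i] * R[i] := if t then (0, 1) else (1, 0).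

(** When letters are vectors acting linearly, and the covariance is bilinear,
    Wick polynomials are multilinear in the entries of the stack. This lets a
    centering property pass to linear combinations of the letters. *)
Lemma wick_multilinear s1 v s2 :
  wick K x (s1 ++ v :: s2) =
  v.1 *: wick K x (s1 ++ e false :: s2) + v.2 *: wick K x (s1 ++ e true :: s2).
Proof.
have base : wick K x (v :: s2) =
    v.1 *: wick K x (e false :: s2) + v.2 *: wick K x (e true :: s2).
  rewrite /x /K /= !scale0r !scale1r addr0 add0r.
  case: s2 => [|y s2]; first by rewrite !subr0 mulrDr !scalerAr.
  rewrite !mulr0 !mulr1 addr0 add0r mulrDr !scalerBr !scalerAr scalerDl !scalerA.
  by rewrite [v.1 * _]mulrC [v.2 * _]mulrC opprD addrACA.
elim: {s1}(size s1) {-2}s1 (leqnn (size s1)) => [|n IH] [|l s1] // sz.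
have := IH s1 sz => /= ->.
rewrite // mulrDl !scalerBr -!scalerAl.
case: s1 sz => [|y s1] sz /=.
  rewrite !scalerA /K /= !mul0r !mul1r addr0 add0r scalerDl.
  by rewrite opprD addrACA.
rewrite IH; last exact: ltnW.
set k := K y l; rewrite scalerDr.
rewrite !scalerA.
rewrite (mulrC k v.1) (mulrC k v.2).
rewrite opprD.
by rewrite addrACA.
Qed.

Lemma linear_wick_centered :
  wick_centered phi (fun s t : bool => (s == t)%:R) (fun t => if t then b else a) ->
  wick_centered phi K x.
Proof.
move=> wc.
have basis t bs : phi (wick K x (map e (t :: bs))) = 0.
  rewrite wick_map -(wc t bs); congr (phi _).
  have eqK : (fun u v => K (e u) (e v)) = (fun s t : bool => (s == t)%:R).
    by apply/funext => -[]; apply/funext => -[]; rewrite /K /= ?mulr0 ?mul0r ?mulr1 ?addr0 ?add0r.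
  have eqx : x \o e = (fun t => if t then b else a).
    by apply/funext => -[]; rewrite /x /= scale0r scale1r ?addr0 ?add0r.
  by rewrite eqK eqx.
have main vs t bs : phi (wick K x (map e (t :: bs) ++ vs)) = 0.
  elim: vs t bs => [|v vs IH] t bs; first by rewrite cats0 basis.
  rewrite wick_multilinear linearD !linearZ /=.
  have step t' : phi (wick K x (map e (t :: bs) ++ e t' :: vs)) = 0.
    by rewrite -cat_rcons -map_rcons; exact: IH.
  by rewrite (step false) (step true) !mulr0 addr0.
move=> v vs; have := wick_multilinear [::] v vs; rewrite !cat0s => ->.
rewrite linearD !linearZ /=.
by rewrite (main vs false [::]) (main vs true [::]) !mulr0 addr0.
Qed.

End LinearChange.

Definition star_letter (c : A) (t : bool) := if t then star c else c.

(** With c = (a + i b) / sqrt 2 the covariances of (c, c) and (star c, star c)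
    cancel, and the one of (c, star c) is 1/2 + 1/2. *)
Lemma circular_wick (c : A) : circular phi c ->
  wick_centered phi (fun s t : bool => (s != t)%:R) (star_letter c).
Proof.
move=> [a [b [sa sb fab def_c]]].
(* c and its adjoint have coordinates q (1, i) and q (1, -i) on (a, b). *)
have wc := linear_wick_centered (free_semicircular_wick sa sb fab).
have [[star_a _ _] [star_b _ _]] := (sa, sb).
pose q : R[i] := (sqrtC 2)^-1.
have q2 : q * q = 2^-1 by rewrite /q -invfM -expr2 sqrtCK.
pose v (t : bool) : R[i] * R[i] := (q, if t then - ('i * q) else 'i * q).
move=> t st; have := wc (v t) (map v st); rewrite -map_cons wick_map => <-.
congr (phi (wick _ _ _)).
  apply/funext => s; apply/funext => u; rewrite /= q2.
  have iq : 'i * q * ('i * q) = - 2^-1 :> R[i].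
    by rewrite mulrACA -expr2 sqrCi q2 mulN1r.
  have h2 : 2^-1 + 2^-1 = 1 :> R[i] by field.
  by case: s; case: u; rewrite /= ?mulNr ?mulrN ?opprK iq ?opprK ?addrN ?h2.
apply/funext => s; rewrite /star_letter def_c /=.
have star_N k (y : A) : star (k *: y) = k^* *: star y by exact: starZ.
have qR : q^* = q by apply/CrealP; rewrite realV realE sqrtC_ge0 ler0n.
case: s; last by rewrite -/q scalerDr scalerA [q * _]mulrC.
by rewrite starZ starD starZ star_a star_b -/q qR conjCi scalerDr scalerA mulrN mulrC.
Qed.

Lemma free_circular_wick (m : nat) (c : 'I_m -> A) :
  (forall j, circular phi (c j)) ->
  free_sets phi (fun j => [set c j; star (c j)]) ->
  wick_centered phi (fun u v : 'I_m * bool => ((u.1 == v.1) && (u.2 != v.2))%:R)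
    (fun v : 'I_m * bool => if v.2 then star (c v.1) else c v.1).
Proof.
move=> c_circ; apply: (@free_wick_centered _ _ _ _ _ fst) => //.
- by move=> i; exact: gen_subalgP.
- by move=> [j []] /=; apply: sub_gen_subalg; [right|left].
- by move=> u v /negbTE ->.
move=> [j t] st st_j; have <- := circular_wick (c_circ j) t (map snd st).
have -> : (j, t) :: st = map (pair j) (t :: map snd st).
  rewrite /= -map_comp; congr (_ :: _).
  by elim: st st_j => //= -[i s] st IH /andP[/eqP /= -> /IH {1}->].
rewrite wick_map; congr (phi (wick _ _ _)).
by apply/funext => s; apply/funext => u; rewrite /= eqxx.
Qed.

(** The joint moments of free circular elements count the noncrossing pairings
    that match every letter with an adjoint of the same index. *)
Lemma free_circular_moment (m : nat) (c : 'I_m -> A) :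
  (forall j, circular phi (c j)) ->
  free_sets phi (fun j => [set c j; star (c j)]) ->
  forall w : seq ('I_m * bool),
  phi (\prod_(v <- w) (if v.2 then star (c v.1) else c v.1)) =
  fock (fun u v : 'I_m * bool => ((u.1 == v.1) && (u.2 != v.2))%:R) w [::].
Proof.
move=> c_circ c_free w.
by rewrite -(wick_moment phi1 (free_circular_wick c_circ c_free)) mul1r.
Qed.

End Circular.

(** * Pairings and their sums over group labels *)

Section Pairings.
Variable T : Type.

Definition del_nth i (st : seq T) := take i st ++ drop i.+1 st.

(** All pairings of [st] with [s] and inside [s], where the letters of [st]
    are open, the last opened first, and have to be matched in [s]. Each
    pairing carries a flag, which is true when every closing letter closes
    the top of the stack, that is, when the pairing is noncrossing. *)
Fixpoint pairings (s st : seq T) : seq (bool * seq (T * T)) :=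
  if s is x :: s' then
    pairings s' (x :: st) ++
    flatten [seq [seq ((i == 0) && p.1, (nth x st i, x) :: p.2)
                 | p <- pairings s' (del_nth i st)] | i <- iota 0 (size st)]
  else if st is [::] then [:: (true, [::])] else [::].

End Pairings.

Lemma map_del_nth (T T' : Type) (f : T' -> T) i st :
  map f (del_nth i st) = del_nth i (map f st).
Proof. by rewrite /del_nth map_cat map_take map_drop. Qed.

Section PairSum.
Variable F : numFieldType.

(** With [q = true] the sum is restricted to the noncrossing pairings. *)
Definition pair_sum (T : Type) (q : bool) (K : T -> T -> F) (s st : seq T) : F :=
  \sum_(p <- pairings s st | q ==> p.1) \prod_(e <- p.2) K e.1 e.2.

Lemma pair_sum_nil (T : Type) q (K : T -> T -> F) st :
  pair_sum q K [::] st = (nilp st)%:R.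
Proof.
case: st => [|y st]; last by rewrite /pair_sum big_nil.
by rewrite /pair_sum big_cons /= implybT !big_nil addr0.
Qed.

Lemma pair_sum_cons (T : Type) q (K : T -> T -> F) x s st :
  pair_sum q K (x :: s) st = pair_sum q K s (x :: st)
    + \sum_(0 <= i < size st | q ==> (i == 0))
        K (nth x st i) x * pair_sum q K s (del_nth i st).
Proof.
rewrite /pair_sum /= big_cat /=; congr (_ + _).
rewrite big_flatten big_map /index_iota subn0 [RHS]big_mkcond.
apply: eq_bigr => i _; rewrite big_map /=; case: q => /=; last first.
  by rewrite big_distrr; apply: eq_bigr => p _; rewrite big_cons.
case: eqP => [_|_] /=; last by rewrite big_pred0.
by rewrite big_distrr; apply: eq_bigr => p _; rewrite big_cons.
Qed.

Lemma pair_sum_fock (T : Type) (K : T -> T -> F) s st :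
  pair_sum true K s st = fock K s st.
Proof.
elim: s st => [|x s IH] st; first by rewrite pair_sum_nil.
rewrite pair_sum_cons IH /=; congr (_ + _); case: st => [|y st]; first by rewrite big_nil.
rewrite big_ltn_cond //= big_nat_cond big_pred0 => [|[|i]]; rewrite ?andbF //.
by rewrite IH /del_nth /= drop0 addr0.
Qed.

Lemma pair_sum_map (T T' : Type) (f : T' -> T) q (K : T -> T -> F) s st :
  pair_sum q K (map f s) (map f st) = pair_sum q (fun u v => K (f u) (f v)) s st.
Proof.
elim: s st => [|x s IH] st; first by rewrite !pair_sum_nil; case: st.
rewrite /= !pair_sum_cons -IH size_map; congr (_ + _).
rewrite big_nat_cond [RHS]big_nat_cond; apply: eq_bigr => i /andP[/andP[_ i_lt] _].
by rewrite (nth_map x) // -IH map_del_nth.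
Qed.

Lemma pair_sum_ge0 (T : Type) q (K : T -> T -> F) s st :
  (forall u v, 0 <= K u v) -> 0 <= pair_sum q K s st.
Proof. by move=> K0; apply: sumr_ge0 => p _; apply: prodr_ge0. Qed.

Lemma pair_sum_norm (T : Type) q (K : T -> T -> F) s st :
  (forall u v, `|K u v| <= 1) -> `|pair_sum q K s st| <= pair_sum q (fun _ _ => 1) s st.
Proof.
move=> K1; apply: le_trans (ler_norm_sum _ _ _) _; apply: ler_sum => p _.
by rewrite normr_prod; apply: ler_prod => e _; rewrite normr_ge0 K1.
Qed.

Lemma pair_sum1_size (T : Type) q (s : seq T) :
  pair_sum q (fun _ _ => 1) s [::] =
  pair_sum q (fun _ _ : unit => 1 : F) (nseq (size s) tt) [::].
Proof.
rewrite -(pair_sum_map (fun _ => tt) q (fun _ _ => 1) s [::]) /=.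
by congr pair_sum; elim: s => //= x s ->.
Qed.

Lemma big_tuple_cons (G : finType) n (E : seq G -> F) :
  \sum_(a : n.+1.-tuple G) E a = \sum_(x : G) \sum_(a : n.-tuple G) E (x :: a).
Proof.
rewrite pair_big /= (reindex (fun p : G * n.-tuple G => [tuple of p.1 :: p.2])) //.
exists (fun a : n.+1.-tuple G => (thead a, [tuple of behead a])) => [[x a] _|a _] /=.
  by congr (_, _); apply/val_inj.
by rewrite -tuple_eta.
Qed.

(** The covariance of independent entries of a convolution matrix: the two labels
    of a pair have to be mutually inverse. *)
Definition label_kernel (G : finGroupType) (L : Type) (K : L -> L -> F)
    (u v : L * G) : F :=
  K u.1 v.1 * ((u.2 * v.2)%g == 1%g)%:R.

(** Summing over the labels of a pair whose product is 1 gives a factor [#|G|],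
    that is, [r] for each position: every pairing of the word counts for
    [r ^+ size w]. Open letters come with a label already chosen, which
    accounts for the power of [r] on the left. *)
Lemma pair_sum_labels (L : Type) (G : finGroupType) q (K : L -> L -> F) (r : F)
    (w : seq L) (st : seq (L * G)) :
  r ^+ 2 = #|G|%:R -> 
  (\sum_(a : (size w).-tuple G)
     pair_sum q (label_kernel K) (zip w a) st) * r ^+ size st =
  r ^+ size w * pair_sum q K w (map fst st).
Proof.
rewrite /label_kernel => r2; elim: w st => [|l w IH] st.
  have zip0 (a : 0.-tuple G) : zip ([::] : seq L) a = [::] by case: (tval a).
  rewrite mul1r pair_sum_nil; case: st => [|y st] /=; last first.
    by rewrite big1 ?mul0r // => a _; rewrite zip0 pair_sum_nil.
  under eq_bigr do rewrite zip0 pair_sum_nil.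
  by rewrite sumr_const card_tuple expn0 mulr1.
have r0 : r != 0.
  apply/eqP => r0; move: r2; rewrite r0 expr0n /= => /esym/eqP; rewrite pnatr_eq0.
  by apply/negP; rewrite -lt0n; apply/card_gt0P; exists 1%g.
rewrite (big_tuple_cons _ (fun a => pair_sum q _ (zip (l :: w) a) st)) /=.
under eq_bigr do (under eq_bigr do rewrite pair_sum_cons; rewrite big_split).
rewrite big_split /= mulrDl [in RHS]pair_sum_cons mulrDr; congr (_ + _).
  apply: (mulIf r0); rewrite -mulrA -exprSr mulr_suml.
  rewrite (eq_bigr (fun _ => r ^+ size w * pair_sum q K w (l :: map fst st))).
    rewrite sumr_const -mulr_natl -r2 expr2 exprS.
    by move: (r ^+ size w) (pair_sum _ _ _ _) => t u; ring.
  by move=> x _; exact: (IH ((l, x) :: st)).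
rewrite (eq_bigr (fun x => \sum_(0 <= i < size st | q ==> (i == 0))
    \sum_(a : (size w).-tuple G) K (nth (l, x) st i).1 l *
      ((nth (l, x) st i).2 * x == 1)%g%:R *
      pair_sum q (fun u v => K u.1 v.1 * (u.2 * v.2 == 1)%g%:R) (zip w a)
        (del_nth i st))); last by move=> x _; rewrite exchange_big.
rewrite exchange_big /= mulr_suml mulr_sumr size_map.
rewrite big_nat_cond [RHS]big_nat_cond; apply: eq_bigr => i /andP[/andP[_ i_lt] _].
have szd : size st = (size (del_nth i st)).+1.
  by rewrite size_cat size_take size_drop i_lt; lia.
pose y := nth (l, 1%g) st i.
have nthE x : nth (l, x) st i = y by apply: set_nth_default.
rewrite (nth_map (l, 1%g)) // -/y -map_del_nth.
have := IH (del_nth i st); set S := \sum_(a : _.-tuple G) _ => IHi.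
have -> : \sum_(x : G) \sum_(a : (size w).-tuple G) K (nth (l, x) st i).1 l *
      ((nth (l, x) st i).2 * x == 1)%g%:R *
      pair_sum q (fun u v => K u.1 v.1 * (u.2 * v.2 == 1)%g%:R) (zip w a)
        (del_nth i st) = K y.1 l * S.
  rewrite (eq_bigr (fun x => K y.1 l * (y.2 * x == 1)%g%:R * S)); last first.
    by move=> x _; rewrite nthE -mulr_sumr.
  rewrite -mulr_suml -mulr_sumr (bigD1 (y.2^-1)%g) //= mulgV eqxx big1 ?addr0 ?mulr1 //.
  by move=> x; rewrite -eq_invg_mul eq_sym => /negbTE ->.
rewrite szd [in LHS]exprS [in RHS]exprS.
rewrite -[RHS]mulrA [in RHS](mulrCA (r ^+ size w)) -IHi.
by rewrite -[LHS]mulrA [S * (r * _)]mulrCA [RHS]mulrCA.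
Qed.

End PairSum.

(** * The Wick formula for variables that occur at most twice *)

Section WickFormula.
Variable F : numFieldType.

Lemma perm_del_nth (T : eqType) (x0 : T) i (st : seq T) : (i < size st)%N ->
  perm_eq st (nth x0 st i :: del_nth i st).
Proof.
move=> i_lt; rewrite -{1}[st](cat_take_drop i) (drop_nth x0) //.
by rewrite perm_catC cat_cons perm_cons perm_catC.
Qed.

(** An open letter without a possible partner cannot be closed. *)
Lemma pair_sum0_open (T : eqType) (K : T -> T -> F) x s st :
  x \in st -> (forall y, y \in s -> K x y = 0) -> pair_sum false K s st = 0.
Proof.
elim: s st => [|y s IH] st x_st Kx0.
  by rewrite pair_sum_nil; case: st x_st.
have Kx0s z : z \in s -> K x z = 0 by move=> zs; apply: Kx0; rewrite inE zs orbT.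
rewrite pair_sum_cons IH ?inE ?x_st ?orbT // add0r.
rewrite big_nat_cond big1 // => i /andP[/andP[_ i_lt] _].
have := perm_mem (perm_del_nth y i_lt) x; rewrite x_st inE => /esym/orP[/eqP <-|x_d].
  by rewrite Kx0 ?mul0r // mem_head.
by rewrite IH // mulr0.
Qed.

Lemma pair_sum0_in (T : eqType) (K : T -> T -> F) x s st :
  x \in s -> (forall y, y \in st ++ s -> K x y = 0 /\ K y x = 0) ->
  pair_sum false K s st = 0.
Proof.
elim: s st => [|y s IH] st // x_s K0.
have [xy|xy] := eqVneq x y.
  rewrite -xy pair_sum_cons (pair_sum0_open (x := x)) ?mem_head //; last first.
    by move=> z zs; case: (K0 z) => //; rewrite mem_cat inE zs !orbT.
  rewrite add0r big_nat_cond big1 // => i /andP[/andP[_ i_lt] _].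
  case: (K0 (nth x st i)) => [|_ ->]; last by rewrite mul0r.
  by rewrite mem_cat mem_nth.
have {}x_s : x \in s by move: x_s; rewrite inE (negPf xy).
rewrite pair_sum_cons IH //; last first.
  by move=> z z_s; apply: K0; move: z_s; rewrite !mem_cat !inE orbCA orbA.
rewrite add0r big_nat_cond big1 // => i /andP[/andP[_ i_lt] _].
rewrite IH ?mulr0 // => z; rewrite mem_cat => z_s; apply: K0.
rewrite mem_cat (perm_mem (perm_del_nth y i_lt)) !inE.
by case/orP: z_s => ->; rewrite ?orbT.
Qed.

Variables (V : finType) (mom : nat -> nat -> F).

Definition opposite (s t : V * bool) : F := ((s.1 == t.1) && (s.2 != t.2))%:R.

(** Joint moment of independent variables indexed by [V], the flag of an
    occurrence marking a complex conjugate; [mom p q] is the common moment with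
    [p] plain and [q] conjugate factors. *)
Definition mixed_moment (s : seq (V * bool)) : F :=
  \prod_(v : V) mom (count_mem (v, false) s) (count_mem (v, true) s).

(** Multiplicity of a variable, with and without conjugation. *)
Definition mult (s : seq (V * bool)) (v : V) := count (fun t => t.1 == v) s.

Lemma multE s v : mult s v = (count_mem (v, false) s + count_mem (v, true) s)%N.
Proof.
elim: s => //= -[u b] s; rewrite /mult /= => ->.
by rewrite !xpair_eqE; case: eqP => _; case: b => //=; lia.
Qed.

Lemma sum_mult s : (\sum_v mult s v)%N = size s.
Proof.
rewrite /mult; under eq_bigr do rewrite -sum1_count big_mkcond.
rewrite exchange_big /= -sum1_size; apply: eq_bigr => t _.
by rewrite (bigD1 t.1) //= eqxx big1 // => v; rewrite eq_sym => /negbTE ->.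
Qed.

Lemma mixed_moment_perm s t : perm_eq s t -> mixed_moment s = mixed_moment t.
Proof. by move=> /seq.permP st; apply: eq_bigr => v _; rewrite !st. Qed.

Lemma mult_perm s t v : perm_eq s t -> mult s v = mult t v.
Proof. by move=> /seq.permP st; exact: st. Qed.

Hypotheses (mom00 : mom 0 0 = 1) (mom10 : mom 1 0 = 0) (mom01 : mom 0 1 = 0).
Hypotheses (mom20 : mom 2 0 = 0) (mom02 : mom 0 2 = 0) (mom11 : mom 1 1 = 1).

Lemma mixed_moment_single s v : mult s v = 1%N -> mixed_moment s = 0.
Proof.
rewrite multE => cv; rewrite /mixed_moment (bigD1 v) //=.
case: (count_mem (v, false) s) cv => [|[|n]]; case: (count_mem (v, true) s) => [|[|k]] //= _.
  by rewrite mom01 mul0r.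
by rewrite mom10 mul0r.
Qed.

Lemma pair_sum_single s v : mult s v = 1%N -> pair_sum false opposite s [::] = 0.
Proof.
move=> v1; have : has (fun t => t.1 == v) s by rewrite has_count -/(mult s v) v1.
case/hasP => x x_s /eqP xv; apply: (pair_sum0_in x_s) => y y_s.
have [yx|yx] := eqVneq y x; first by rewrite yx /opposite !eqxx andbF.
suff nxy : x.1 != y.1.
  by rewrite /opposite (negPf nxy) [y.1 == _]eq_sym (negPf nxy).
apply/eqP => xy; suff : (2 <= mult s v)%N by rewrite v1.
have := perm_to_rem x_s => /mult_perm ->; rewrite /mult /= xv eqxx.
rewrite -(@subnKC 1 2) // leq_add2l -has_count; apply/hasP; exists y; last by rewrite -xy xv.
by have := perm_mem (perm_to_rem x_s) y; rewrite inE (negPf yx) /= => <-.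
Qed.

(** When no variable occurs three times, at most one pairing matches equal
    variables, and independence evaluates both sides to 1 if it exists and
    matches conjugated with nonconjugated occurrences, and to 0 otherwise.
    The induction opens or closes one letter at a time, and the open letters
    stay pairwise distinct. *)
Lemma mixed_moment_wick s st :
  (forall v, mult (st ++ s) v <= 2)%N -> uniq (map fst st) ->
  mixed_moment (st ++ s) = pair_sum false opposite s st.
Proof.
elim: s st => [|x s IH] st mult2 uniq_st.
  rewrite pair_sum_nil cats0; case: st mult2 uniq_st => [_ _|y st mult2 /= /andP[y_st uniq_st]].
    by rewrite /mixed_moment big1.
  apply: (mixed_moment_single (v := y.1)); rewrite /mult /= eqxx.
  suff -> : count (fun t => t.1 == y.1) st = 0%N by [].
  apply/eqP; rewrite -leqn0 leqNgt -has_count; apply: contra y_st.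
  by move=> /hasP[t t_st /eqP <-]; apply: map_f.
have perm_x : perm_eq (st ++ x :: s) ((x :: st) ++ s).
  by rewrite -cat_rcons -cats1 perm_cat2r perm_catC.
rewrite pair_sum_cons; have [x_st|x_st] := boolP (x.1 \in map fst st); last first.
  rewrite -IH ?(mixed_moment_perm perm_x) /= ?x_st //; last first.
    by move=> v; have := mult2 v; rewrite (mult_perm _ perm_x).
  rewrite big_nat_cond big1 ?addr0 // => i /andP[/andP[_ i_lt] _].
  rewrite /opposite; case: eqP => [e|_]; last by rewrite mul0r.
  by case/negP: x_st; rewrite -e; apply: map_f; apply: mem_nth.
case/(nthP x.1): x_st => i; rewrite size_map => i_lt; rewrite (nth_map x) //.
set y := nth x st i => yx.
have perm_y := perm_del_nth x i_lt; rewrite -/y in perm_y.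
have x_s : ~~ has (fun t => t.1 == x.1) s.
  rewrite has_count -leqNgt; have := mult2 x.1.
  rewrite (mult_perm _ perm_x) /mult cat_cons /= eqxx count_cat.
  by rewrite (seq.permP perm_y) /= yx eqxx; lia.
have Kxs t : t \in s -> opposite x t = 0.
  move=> t_s; rewrite /opposite; case: eqP => //= xt.
  by case/negP: x_s; apply/hasP; exists t => //; rewrite xt.
(* [x] has to close [y]: opened, it would never be closed, as no third
   occurrence of its variable is left. *)
rewrite (pair_sum0_open (x := x)) ?mem_head // add0r.
rewrite big_mkord (bigD1 (Ordinal i_lt)) //= big1 ?addr0 => [|j ji]; last first.
  suff /negbTE nyx : (nth x st j).1 != x.1 by rewrite /opposite nyx mul0r.
  apply: contra ji => /eqP e; rewrite -val_eqE /=.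
  by rewrite -(nth_uniq x.1 _ _ uniq_st) ?size_map // !(nth_map x) // e -/y yx.
rewrite -/y.
have perm_all : perm_eq (st ++ x :: s) (x :: y :: (del_nth i st ++ s)).
  by rewrite (perm_trans perm_x) //= perm_cons -cat_cons perm_cat2r.
have rest0 b : count_mem (x.1, b) (del_nth i st ++ s) = 0%N.
  have : mult (del_nth i st ++ s) x.1 = 0%N.
    have := mult2 x.1; rewrite (mult_perm _ perm_all) {1}/mult /= eqxx yx eqxx.
    by rewrite -/(mult (del_nth i st ++ s) x.1); lia.
  by rewrite multE => /eqP; rewrite addn_eq0 => /andP[/eqP e0 /eqP e1]; case: b.
have [bxy|bxy] := eqVneq x.2 y.2.
  rewrite /opposite yx eqxx bxy eqxx mul0r (mixed_moment_perm perm_all).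
  rewrite /mixed_moment (bigD1 x.1) //= !rest0.
  rewrite [x]surjective_pairing [y]surjective_pairing yx -bxy !xpair_eqE !eqxx /=.
  by case: (x.2) => /=; rewrite ?mom20 ?mom02 mul0r.
rewrite /opposite yx eqxx eq_sym bxy mul1r -IH; last first.
- by move: uniq_st; rewrite (perm_uniq (perm_map fst perm_y)) => /andP[].
- move=> v; apply: leq_trans (mult2 v).
  by rewrite (mult_perm _ perm_all) /mult /= addnA leq_addl.
rewrite (mixed_moment_perm perm_all) /mixed_moment (bigD1 x.1) //= [RHS](bigD1 x.1) //=.
rewrite !rest0 mom00; congr (_ * _).
  rewrite [x]surjective_pairing [y]surjective_pairing yx !xpair_eqE !eqxx /=.
  by move: bxy; case: (x.2); case: (y.2) => //= _; rewrite mom11.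
apply: eq_bigr => v vx; rewrite [x]surjective_pairing [y]surjective_pairing yx.
by rewrite !xpair_eqE eq_sym (negPf vx).
Qed.

(** Only the variables that occur contribute a factor other than 1. *)
Lemma mixed_moment_bound (M : F) s : 1 <= M ->
  (forall p q, (p <= size s)%N -> (q <= size s)%N -> `|mom p q| <= M) ->
  `|mixed_moment s| <= M ^+ size s.
Proof.
move=> M1 momM; rewrite normr_prod.
rewrite -sum_mult expr_sum; apply: ler_prod => v _; rewrite normr_ge0 /= multE.
have [e0|e0] := posnP (count_mem (v, false) s + count_mem (v, true) s).
  by rewrite e0; move/eqP: e0; rewrite addn_eq0 => /andP[/eqP -> /eqP ->]; rewrite mom00 normr1.
apply: le_trans (momM _ _ (count_size _ _) (count_size _ _)) _.
by rewrite -{1}[M]expr1; apply: ler_weXn2l.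
Qed.

End WickFormula.

(** * Crossing pairings and commuting pairs *)

Section CommutingPairs.
Variable gT : finGroupType.

Definition commuting_pairs := (\sum_(x : gT) #|'C[x]%g|)%N.

(** Burnside's orbit counting, for the action by conjugation. *)
Lemma commuting_pairs_classes :
  commuting_pairs = (#|classes [set: gT]%G| * #|gT|)%N.
Proof.
rewrite /commuting_pairs -cardsT.
have cl : classes [set: gT]%G = orbit (conjg_action gT) [set: gT]%G @: [set: gT]%G.
  by apply: eq_imset => x; rewrite orbitJ.
rewrite cl -(Frobenius_Cauchy (to := (conjg_action gT))); last first.
  by apply/fintype.subsetP => x _; rewrite !inE; apply/fintype.subsetP => y _; rewrite !inE.
by apply: eq_big => [x|x _]; rewrite ?inE // afixJ finset.setTI cent_set1.
Qed.

End CommutingPairs.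

Section CrossingShape.
Variable T : eqType.

Lemma mem_pairings_cons x s st (p : bool * seq (T * T)) :
  p \in pairings (x :: s) st ->
  p \in pairings s (x :: st) \/
  exists i q, [/\ (i < size st)%N, q \in pairings s (del_nth i st)
                & p = ((i == 0) && q.1, (nth x st i, x) :: q.2)].
Proof.
rewrite [pairings _ _]/= mem_cat => /orP[|/allpairsPdep[i [q [i_lt qs ->]]]].
  by left.
by right; exists i, q; rewrite mem_iota in i_lt.
Qed.

Lemma pairings_open_matched s st (p : bool * seq (T * T)) y :
  p \in pairings s st -> y \in st -> exists2 z, z \in s & (y, z) \in p.2.
Proof.
elim: s st p => [|x s IH] st p; first by case: st.
case/mem_pairings_cons => [ps y_st|[i [p' [i_lt p's ->]]] y_st /=].
  have [|z z_s z_p] := IH _ _ ps; first by rewrite inE y_st orbT.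
  by exists z; rewrite // inE z_s orbT.
have := perm_mem (perm_del_nth x i_lt) y; rewrite y_st inE.
case/esym/orP => [/eqP ->|y_d]; first by exists x; rewrite mem_head.
by have [z z_s z_p] := IH _ _ p's y_d; exists z; rewrite inE ?z_s ?z_p orbT.
Qed.

Lemma pairings_cover s st (p : bool * seq (T * T)) : p \in pairings s st ->
  perm_eq (flatten [seq [:: e.1; e.2] | e <- p.2]) (st ++ s).
Proof.
elim: s st p => [|x s IH] st p.
  by case: st => //; rewrite inE => /eqP ->.
case/mem_pairings_cons => [/IH|[i [p' [i_lt /IH p's ->]]] /=].
  by move=> /permPl ->; rewrite -cat_rcons -cats1 perm_cat2r perm_sym perm_catC.
apply/seq.permP => a; have := seq.permP p's a.
have := seq.permP (perm_del_nth x i_lt) a.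
by rewrite /= !count_cat /=; lia.
Qed.

(** The flag is lost when a letter [x] closes an entry below the top [y0] of the
    stack; as [y0] is older than [x] and has to be closed later, the two pairs
    cross. *)
Lemma pairings_crossing s st (p : bool * seq (T * T)) :
  p \in pairings s st -> ~~ p.1 ->
  exists i j k l, [/\ subseq [:: i; j; k; l] (rev st ++ s),
                      (i, k) \in p.2 & (j, l) \in p.2].
Proof.
elim: s st p => [|x s IH] st p.
  by case: st => //; rewrite inE => /eqP ->.
case/mem_pairings_cons => [ps pn|[i [p' [i_lt p's ->]]] /=].
  have [i [j [k [l [ijkl ik jl]]]]] := IH _ _ ps pn.
  by exists i, j, k, l; split=> //; rewrite rev_cons cat_rcons in ijkl.
rewrite negb_and => pn.
have [p'1|/(IH _ _ p's)] := boolP p'.1; last first.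
  move=> [i' [j [k [l [ijkl ik jl]]]]]; exists i', j, k, l; split; rewrite ?inE ?ik ?jl ?orbT //.
  apply: subseq_trans ijkl _; apply: cat_subseq; last exact: subseq_cons.
  by rewrite subseq_rev -{2}[st](cat_take_drop i) cat_subseq // (drop_nth x i_lt) subseq_cons.
case: i i_lt p's pn => [|i]; first by rewrite p'1.
case: st => // y0 st; rewrite /= ltnS => i_lt p's _.
have [|z z_s z_p] := pairings_open_matched p's (y := y0); first by rewrite mem_head.
exists (nth x st i), y0, x, z; split; rewrite ?mem_head ?inE ?z_p ?orbT //.
rewrite rev_cons -cats1 -[[:: _; _; _; _]]/([:: nth x st i] ++ [:: y0] ++ [:: x; z]) -catA.
do 2![apply: cat_subseq; rewrite ?sub1seq ?mem_rev ?mem_head ?mem_nth //].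
by rewrite /= eqxx sub1seq.
Qed.

Lemma pair_disjoint (p : seq (T * T)) e f :
  uniq (flatten [seq [:: e.1; e.2] | e <- p]) -> e \in p -> f \in p ->
  e = f \/ [/\ e.1 != f.1, e.1 != f.2, e.2 != f.1 & e.2 != f.2].
Proof.
elim: p => // g p IH /= /and3P[g1 g2 up].
have mem_p h : h \in p -> [/\ g.1 != h.1, g.1 != h.2, g.2 != h.1 & g.2 != h.2].
  move=> hp; move: g1 g2; rewrite inE negb_or => /andP[_].
  have h1 : h.1 \in flatten [seq [:: e.1; e.2] | e <- p].
    by apply/flatten_mapP; exists h; rewrite // mem_head.
  have h2 : h.2 \in flatten [seq [:: e.1; e.2] | e <- p].
    by apply/flatten_mapP; exists h; rewrite // !inE eqxx orbT.
  by move=> g1 g2; split; apply/eqP => gh; move: g1 g2; rewrite gh ?h1 ?h2.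
rewrite !inE => /orP[/eqP ->|ep] /orP[/eqP ->|fp].
- by left.
- by right; exact: mem_p.
- by right; have [? ? ? ?] := mem_p _ ep; split; rewrite eq_sym.
- exact: IH.
Qed.

End CrossingShape.

Section CommutatorCount.
Variable G : finGroupType.
Local Open Scope group_scope.

(** If not empty, this set is a left translate of the centralizer. *)
Lemma card_conjugators (u v : G) : (#|[set x : G | (x * u * x^-1)%g == v]%SET| <= #|'C[u]|)%N.
Proof.
have [->|[x0]] := set_0Vmem [set x : G | (x * u * x^-1)%g == v]%SET; first by rewrite cards0.
rewrite inE => /eqP x0_uv.
rewrite -(card_imset _ (mulgI x0^-1)); apply: subset_leq_card.
apply/fintype.subsetP => _ /imsetP[x + ->]; rewrite inE => /eqP x_uv.
have xu : x * u = v * x by rewrite -x_uv mulgKV.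
have x0u : u * x0^-1 = x0^-1 * v by rewrite -x0_uv !mulgA mulVg mul1g.
by apply/cent1P; rewrite /commute -mulgA xu mulgA [RHS]mulgA x0u.
Qed.

(** For fixed [z], the word is 1 when [x] conjugates [p2 * z * p3] to a given
    element. The number of such [x] is at most the order of a centralizer, and
    [p2 * z * p3] runs over the whole group with [z]. *)
Lemma commutator_word_count (p1 p2 p3 p4 p5 : G) :
  (\sum_x \sum_z ((p1 * x * p2 * z * p3 * x^-1 * p4 * z^-1 * p5)%g == 1%g)
     <= commuting_pairs G)%N.
Proof.
rewrite exchange_big /= /commuting_pairs.
rewrite [X in (_ <= X)%N](reindex (fun z => p2 * z * p3)) /=; last first.
  exists (fun z => p2^-1 * z * p3^-1) => z _.
    by rewrite !mulgA mulVg mul1g mulgK.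
  by rewrite !mulgA mulgV mul1g mulgKV.
apply: leq_sum => z _; apply: leq_trans (card_conjugators _ (p1^-1 * p5^-1 * z * p4^-1)).
rewrite -sum1dep_card [X in (_ <= X)%N]big_mkcond; apply: leq_sum => x _.
case: (p1 * x * _ * _ * _ * _ * _ * _ * _ =P 1) => // word1.
suff -> : x * (p2 * z * p3) * x^-1 = p1^-1 * p5^-1 * z * p4^-1 by rewrite eqxx.
set c := _ * x^-1; pose d := p4 * z^-1 * p5.
have word_c : p1 * c * d = 1 by rewrite /c /d !mulgA in word1 *.
rewrite -[c](mulKg p1) -[p1 * c](mulgK d) word_c mul1g.
by rewrite !invMg invgK !mulgA.
Qed.

End CommutatorCount.

(** * Labellings of a word compatible with a pairing *)

Section LabelledPairings.
Variables (F : numFieldType) (G : finGroupType).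

(** The product of the labels read so far is the product of the labels on the
    stack: closing the top cancels two adjacent factors. So a noncrossing
    pairing only sees labellings with product 1. *)
Lemma noncrossing_product (L : Type) (K : L -> L -> F) (s st : seq (L * G)) :
  ((\prod_(u <- rev st) u.2) * \prod_(u <- s) u.2)%g != 1%g ->
  fock (label_kernel K) s st = 0.
Proof.
elim: s st => [|x s IH] st /=.
  by case: st => [|y st] //; rewrite !big_nil mulg1 eqxx.
rewrite big_cons mulgA => st_s; rewrite IH ?add0r; last by rewrite rev_cons big_rcons.
case: st st_s => [//|y st]; rewrite rev_cons big_rcons /= => st_s.
rewrite /label_kernel; case: eqP => [yx|_]; last by rewrite mulr0 mul0r.
by rewrite IH ?mulr0 //; rewrite -[(_ * y.2 * x.2)%g]mulgA yx mulg1 in st_s.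
Qed.

Lemma subseq_split (T : eqType) (x : T) s t : subseq (x :: s) t ->
  exists t1 t2, t = t1 ++ x :: t2 /\ subseq s t2.
Proof.
elim: t => //= y t IH; case: eqP => [->|_]; first by exists [::], t.
by case/IH => t1 [t2 [-> st2]]; exists (y :: t1), t2.
Qed.

Section Resampling.
Variables (n : nat) (i j k l : 'I_n).

Definition resample_left (x z : G) (p : 'I_n) : G :=
  if p == k then (x^-1)%g else if p == l then (z^-1)%g else 1%g.

Definition resample_right (x z : G) (p : 'I_n) : G :=
  if p == i then x else if p == j then z else 1%g.

(** Changes the labels of the crossing pairs (i, k) and (j, l) without changing
    the product of the labels of either pair. *)
Definition resample (x z : G) (a : n.-tuple G) : n.-tuple G :=
  [tuple (resample_left x z p * tnth a p * resample_right x z p)%g | p < n].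

Lemma resampleK x z : cancel (resample x z) (resample x^-1 z^-1).
Proof.
move=> a; apply: eq_from_tnth => p; rewrite !tnth_mktuple.
rewrite /resample_left /resample_right.
by case: (p == k); case: (p == l); case: (p == i); case: (p == j);
   rewrite ?mulg1 ?mul1g ?invgK ?mulgKV ?mulKVg ?mulgK ?mulKg // -!mulgA ?mulgV ?mulg1 ?mulKVg.
Qed.

Hypothesis ijkl : subseq [:: i; j; k; l] (enum 'I_n).

Let ijkl_uniq : uniq [:: i; j; k; l].
Proof. exact: subseq_uniq ijkl (enum_uniq _). Qed.

Lemma resample_other x z a p : p \notin [:: i; j; k; l] ->
  tnth (resample x z a) p = tnth a p.
Proof.
rewrite !inE !negb_or => /and4P[pi pj pk pl].
rewrite tnth_mktuple /resample_left /resample_right.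
by rewrite (negPf pi) (negPf pj) (negPf pk) (negPf pl) mulg1 mul1g.
Qed.

Lemma resampleE x z a :
  [/\ tnth (resample x z a) i = (tnth a i * x)%g,
      tnth (resample x z a) k = (x^-1 * tnth a k)%g,
      tnth (resample x z a) j = (tnth a j * z)%g
    & tnth (resample x z a) l = (z^-1 * tnth a l)%g].
Proof.
move: ijkl_uniq; rewrite /= !inE !negb_or -!andbA => /and5P[ij ik il jk /and3P[jl kl _]].
rewrite !tnth_mktuple /resample_left /resample_right !eqxx.
by split; rewrite ?(negPf ij) ?(negPf ik) ?(negPf il) ?(negPf jk) ?(negPf jl) ?(negPf kl)
   ?(eq_sym k) ?(eq_sym l) ?(eq_sym j i)
   ?(negPf ij) ?(negPf ik) ?(negPf il) ?(negPf jk) ?(negPf jl) ?(negPf kl)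
   ?mulg1 ?mul1g.
Qed.

(** The positions are in the order i < j < k < l, so that [x], [z], their
    inverses and the untouched stretches form the word of
    [commutator_word_count]. *)
Lemma resample_word_count (a : n.-tuple G) :
  (\sum_x \sum_z ((\prod_(g <- resample x z a) g)%g == 1%g) <= commuting_pairs G)%N.
Proof.
have [t1 [t2 [def_t jt2]]] := subseq_split ijkl.
have [t3 [t4 [def_t2 kt4]]] := subseq_split jt2.
have [t5 [t6 [def_t4 lt6]]] := subseq_split kt4.
have [t7 [t8 [def_t6 _]]] := subseq_split lt6.
rewrite {}def_t6 in def_t4; rewrite {}def_t4 in def_t2; rewrite {}def_t2 in def_t.
pose A (t : seq 'I_n) := (\prod_(p <- t) tnth a p)%g.
pose p1 := (A t1 * tnth a i)%g; pose p2 := (A t3 * tnth a j)%g; pose p3 := A t5.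
pose p4 := (tnth a k * A t7)%g; pose p5 := (tnth a l * A t8)%g.
apply: leq_trans (commutator_word_count p1 p2 p3 p4 p5).
apply: leq_sum => x _; apply: leq_sum => z _.
set b := resample x z a.
have [bi bk bj bl] := resampleE x z a; rewrite -/b in bi bk bj bl.
have bE : (\prod_(g <- b) g)%g = (\prod_(p <- enum 'I_n) tnth b p)%g.
  by rewrite -[in LHS](map_tnth_enum b) big_map.
have uniq_t : uniq (t1 ++ i :: t3 ++ j :: t5 ++ k :: t7 ++ l :: t8).
  by rewrite -def_t enum_uniq.
have rest_out p : p \in t1 ++ t3 ++ t5 ++ t7 ++ t8 -> p \notin [:: i; j; k; l].
  have : uniq ([:: i; j; k; l] ++ t1 ++ t3 ++ t5 ++ t7 ++ t8).
    rewrite (perm_uniq (s2 := t1 ++ i :: t3 ++ j :: t5 ++ k :: t7 ++ l :: t8)) //.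
    apply/seq.permP => c; do 5 rewrite ?count_cat /=.
    move: (c i : nat) (c j : nat) (c k : nat) (c l : nat) => ? ? ? ?.
    by move: (count c t1) (count c t3) (count c t5) (count c t7) (count c t8); lia.
  by rewrite cat_uniq => /and3P[_ /hasPn out _] /out.
have A_b t : {subset t <= t1 ++ t3 ++ t5 ++ t7 ++ t8} ->
    (\prod_(p <- t) tnth b p)%g = A t.
  move=> tC; rewrite /A big_seq_cond [RHS]big_seq_cond.
  by apply: eq_bigr => p /andP[pt _]; apply: resample_other; exact/rest_out/tC.
rewrite bE def_t !(big_cat, big_cons) /= bi bk bj bl.
rewrite !A_b; try by move=> p pt; rewrite !mem_cat pt ?orbT.
suff -> : (A t1 * (tnth a i * x * (A t3 * (tnth a j * z * (A t5 * (x^-1 * tnth a k *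
    (A t7 * (z^-1 * tnth a l * A t8))))))))%g =
    (p1 * x * p2 * z * p3 * x^-1 * p4 * z^-1 * p5)%g by [].
by rewrite /p1 /p2 /p3 /p4 /p5 !mulgA.
Qed.

End Resampling.

Section WickCount.
Variables (L : Type) (K : L -> L -> F) (w : seq L).
Hypothesis K_ge0 : forall u v, 0 <= K u v.
Let n := size w.
Let kappa (a : n.-tuple G) (p q : 'I_n) : F :=
  label_kernel K (tnth (in_tuple w) p, tnth a p) (tnth (in_tuple w) q, tnth a q).

Lemma zip_positions (a : n.-tuple G) :
  zip w a = [seq (tnth (in_tuple w) p, tnth a p) | p <- enum 'I_n].
Proof.
rewrite -[X in zip X _](map_tnth_enum (in_tuple w)) -[X in zip _ X](map_tnth_enum a).
by elim: (enum 'I_n) => //= p s ->.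
Qed.

Lemma pair_sum_positions q (a : n.-tuple G) :
  pair_sum q (label_kernel K) (zip w a) [::] = pair_sum q (kappa a) (enum 'I_n) [::].
Proof.
rewrite zip_positions.
exact: (pair_sum_map (fun p => (tnth (in_tuple w) p, tnth a p)) q
  (label_kernel K) (enum 'I_n) [::]).
Qed.

(** Resampling permutes the labellings compatible with the pairing, so the
    condition of having product 1 may be averaged over all [x] and [z]; the
    average is at most the proportion of commuting pairs. *)
Lemma crossing_pairing_bound (p : bool * seq ('I_n * 'I_n)) :
  p \in pairings (enum 'I_n) [::] -> ~~ p.1 ->
  (\sum_(a : n.-tuple G) ((\prod_(g <- a) g)%g == 1%g)%:R * \prod_(e <- p.2) kappa a e.1 e.2)
    * #|G|%:R ^+ 2 <=
  (commuting_pairs G)%:R * \sum_(a : n.-tuple G) \prod_(e <- p.2) kappa a e.1 e.2.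
Proof.
move=> p_in pn.
have [i [j [k [l [ijkl ik jl]]]]] := pairings_crossing p_in pn.
have uniq_p : uniq (flatten [seq [:: e.1; e.2] | e <- p.2]).
  by rewrite (perm_uniq (pairings_cover p_in)) enum_uniq.
rewrite /= in ijkl.
pose W a := \prod_(e <- p.2) kappa a e.1 e.2.
have W_resample x z a : W (resample i j k l x z a) = W a.
  rewrite /W big_seq_cond [RHS]big_seq_cond; apply: eq_bigr => e /andP[ep _].
  have [ai ak aj al] := resampleE ijkl x z a.
  rewrite /kappa /label_kernel /=; congr (_ * _%:R).
  have [->|[eik1 eik2 eik3 eik4]] := pair_disjoint uniq_p ep ik.
    by rewrite /= ai ak !mulgA mulgK.
  have [->|[ejl1 ejl2 ejl3 ejl4]] := pair_disjoint uniq_p ep jl.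
    by rewrite /= aj al !mulgA mulgK.
  rewrite !resample_other //; rewrite !inE !negb_or /=.
    by rewrite eik3 eik4 ejl3 ejl4.
  by rewrite eik1 eik2 ejl1 ejl2.
(* Sum the invariance under resampling over the |G|^2 choices of (x, z). *)
have -> : (\sum_(a : n.-tuple G) ((\prod_(g <- a) g)%g == 1%g)%:R * W a) * #|G|%:R ^+ 2 =
    \sum_(a : n.-tuple G) W a *
      (\sum_x \sum_z ((\prod_(g <- resample i j k l x z a) g)%g == 1%g) : nat)%:R.
  set S := \sum_(a : n.-tuple G) _.
  have stepS x z : \sum_(a : n.-tuple G)
      W a * ((\prod_(g <- resample i j k l x z a) g)%g == 1%g)%:R = S.
    rewrite [RHS](reindex_inj (can_inj (resampleK i j k l x z))) /=.
    by apply: eq_bigr => a _; rewrite W_resample mulrC.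
  transitivity (\sum_(x : G) \sum_(z : G) S).
    by rewrite !sumr_const -mulrnA -[RHS]mulr_natr natrM expr2.
  under [RHS]eq_bigr => a _ do rewrite natr_sum mulr_sumr.
  rewrite [RHS]exchange_big /=; apply: eq_bigr => x _.
  under [RHS]eq_bigr => a _ do rewrite natr_sum mulr_sumr.
  by rewrite [RHS]exchange_big /=; apply: eq_bigr => z _; rewrite stepS.
rewrite mulr_sumr; apply: ler_sum => a _; rewrite mulrC.
apply: ler_wpM2r; last by rewrite ler_nat resample_word_count.
by apply: prodr_ge0 => e _; rewrite mulr_ge0.
Qed.

(** Noncrossing pairings give the main term exactly, and crossing ones the error. *)
Lemma wick_count (r : F) : 0 <= r -> r ^+ 2 = #|G|%:R ->
  `|\sum_(a : n.-tuple G) ((\prod_(g <- a) g)%g == 1%g)%:R *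
      pair_sum false (label_kernel K) (zip w a) [::] - r ^+ n * fock K w [::]|
    <= (commuting_pairs G)%:R / #|G|%:R ^+ 2 * (r ^+ n * pair_sum false K w [::]).
Proof.
move=> r0 r2.
have G0 : 0 < #|G|%:R :> F by rewrite ltr0n; apply/card_gt0P; exists 1%g.
have noncross : \sum_(a : n.-tuple G) ((\prod_(g <- a) g)%g == 1%g)%:R *
      pair_sum true (label_kernel K) (zip w a) [::] = r ^+ n * fock K w [::].
  rewrite -pair_sum_fock -(pair_sum_labels true K w [::] r2) mulr1.
  apply: eq_bigr => a _; case: eqP => [_|/eqP a1]; first by rewrite mul1r.
  rewrite mul0r pair_sum_fock noncrossing_product // big_nil mul1g.
  suff -> : (\prod_(u <- zip w a) u.2 = \prod_(g <- a) g)%g by [].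
  by rewrite -{2}[tval a](@unzip2_zip _ _ w) ?size_tuple // big_map.
rewrite -noncross -sumrB.
pose cross (a : n.-tuple G) := \sum_(p <- pairings (enum 'I_n) [::] | ~~ p.1)
  \prod_(e <- p.2) kappa a e.1 e.2.
have crossE (a : n.-tuple G) : pair_sum false (label_kernel K) (zip w a) [::] =
    pair_sum true (label_kernel K) (zip w a) [::] + cross a.
  by rewrite !pair_sum_positions /pair_sum (bigID fst).
rewrite (eq_bigr (fun a : n.-tuple G => ((\prod_(g <- a) g)%g == 1%g)%:R * cross a)); last first.
  by move=> a _; rewrite crossE mulrDr addrAC addrN add0r.
have W_ge0 (a : n.-tuple G) (p : bool * seq ('I_n * 'I_n)) :
    0 <= \prod_(e <- p.2) kappa a e.1 e.2.
  by apply: prodr_ge0 => e _; rewrite mulr_ge0.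
rewrite ger0_norm; last first.
  by apply: sumr_ge0 => a _; rewrite mulr_ge0 // sumr_ge0.
have total : \sum_(a : n.-tuple G) \sum_(p <- pairings (enum 'I_n) [::])
    \prod_(e <- p.2) kappa a e.1 e.2 = r ^+ n * pair_sum false K w [::].
  rewrite -(pair_sum_labels false K w [::] r2) mulr1; apply: eq_bigr => a _.
  exact/esym/pair_sum_positions.
rewrite -total exchange_big /= mulr_sumr /cross.
under eq_bigr do rewrite mulr_sumr.
rewrite exchange_big /= big_mkcond big_seq [in leRHS]big_seq.
apply: ler_sum => p p_in; case: ifP => pn; last first.
  by rewrite mulr_ge0 ?sumr_ge0 // divr_ge0 // ?exprn_ge0.
rewrite mulrAC ler_pdivlMr ?exprn_gt0 //.
exact: crossing_pairing_bound.
Qed.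

End WickCount.
End LabelledPairings.

(** * The moment of a word, up to an explicit error *)

Section MomentEstimate.
Variables (F : numFieldType) (J : finType) (G : finGroupType).

Definition circular_kernel (u v : J * bool) : F := ((u.1 == v.1) && (u.2 != v.2))%:R.

(** The entry of the convolution matrix, or of its adjoint, that a factor with
    label [u.2] contributes: the adjoint replaces the label by its inverse. *)
Definition variable_of (u : (J * bool) * G) : (J * G) * bool :=
  ((u.1.1, if u.1.2 then (u.2^-1)%g else u.2), u.1.2).

(** Because of that inverse, two factors use the same variable with opposite
    conjugation precisely when their labels multiply to 1. *)
Lemma opposite_variables u v :
  opposite F (variable_of u) (variable_of v) = label_kernel circular_kernel u v.
Proof.
case: u => [[j b] x]; case: v => [[j' b'] y].
rewrite /opposite /label_kernel /circular_kernel /= xpair_eqE -natrM mulnb; congr (_%:R).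
rewrite -!andbA; case: (j == j') => //=; rewrite andbC.
case: b; case: b'; rewrite ?andbF //= -?eq_invg_mul ?andbT //.
by rewrite -(inj_eq invg_inj) invgK.
Qed.

Variable w : seq (J * bool).
Let n := size w.
Let vars (a : n.-tuple G) := map variable_of (zip w a).

(** The labellings on which the Wick formula fails while the expectation may not
    vanish. *)
Definition bad_labels (a : n.-tuple G) :=
  [exists v, 2 < mult (vars a) v]%N && [forall v, mult (vars a) v != 1%N].

Lemma size_vars a : size (vars a) = n.
Proof. by rewrite size_map size_zip size_tuple minnn. Qed.

Lemma bad_support a : bad_labels a ->
  (#|[pred v | 0 < mult (vars a) v]| <= n.-1./2)%N.
Proof.
case/andP => /existsP[v v3] /forallP not1.
suff : (#|[pred v | 0 < mult (vars a) v]|.*2 < n)%N.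
  by move=> ltn; rewrite geq_half_double; lia.
rewrite -(size_vars a) -sum_mult (bigD1 v) //= (cardD1 v) inE.
have -> : (0 < mult (vars a) v)%N by exact: leq_trans v3.
set D := #|_|; suff : (D.*2 <= \sum_(u | u != v) mult (vars a) u)%N.
  by rewrite add1n doubleS => le_D; exact: (leq_add v3 le_D).
rewrite -muln2 -sum_nat_const.
apply: leq_trans (_ : \sum_(u in [predD1 [pred u | 0 < mult (vars a) u] & v])
  mult (vars a) u <= _)%N.
  by apply: leq_sum => u; rewrite !inE => /andP[_ u0]; have := not1 u; lia.
rewrite [X in (_ <= X)%N](bigID (fun u => 0 < mult (vars a) u)%N) /=.
by apply: leq_trans (leq_addr _ _); apply: eq_leq; apply: eq_bigl => u; rewrite !inE.
Qed.

(** A bad labelling takes its variables from a set of at most (n - 1)/2 of them: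
    it is coded by the values of these variables and by the choice of one of
    them at each position. *)
Lemma card_bad_labels : (#|[set a | bad_labels a]%SET| <= n ^ n * #|G| ^ (n.-1./2))%N.
Proof.
pose b := n.-1./2.
pose letter (p : 'I_n) := tnth (in_tuple w) p.
pose decode (fh : {ffun 'I_n -> 'I_b} * {ffun 'I_b -> G}) : n.-tuple G :=
  [tuple (if (letter p).2 then ((fh.2 (fh.1 p))^-1)%g else fh.2 (fh.1 p)) | p < n].
apply: (@leq_trans #|[set decode fh | fh : {ffun 'I_n -> 'I_b} * {ffun 'I_b -> G}]%SET|).
  apply: subset_leq_card; apply/fintype.subsetP => a; rewrite inE => bad_a.
  have supp := bad_support bad_a; rewrite -/b in supp.
  have /andP[/existsP[v0 _] _] := bad_a.
  pose e := enum [pred v | 0 < mult (vars a) v]%N.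
  pose v (p : 'I_n) := (variable_of (letter p, tnth a p)).1.
  have v_e p : v p \in e.
    rewrite mem_enum inE -has_count; apply/hasP; exists (variable_of (letter p, tnth a p)) => //.
    rewrite /vars zip_positions map_f //; apply/mapP; exists p; rewrite ?mem_enum //.
  have lt_b p : (index (v p) e < b)%N.
    by apply: leq_trans supp; rewrite cardE index_mem.
  apply/imsetP; exists ([ffun p => Ordinal (lt_b p)], [ffun t : 'I_b => (nth v0 e t).2]) => //.
  apply: eq_from_tnth => p; rewrite tnth_mktuple !ffunE /= nth_index //= /v /=.
  by case: (letter p).2 => /=; rewrite ?invgK.
apply: leq_trans (leq_imset_card _ _) _; rewrite card_prod !card_ffun !card_ord.
rewrite leq_mul2r; apply/orP; right.
have b_n : (b <= n)%N by rewrite /b; lia.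
by case: (posnP n) => [->//|n0]; rewrite leq_exp2r.
Qed.

Variable mom : nat -> nat -> F.
Hypotheses (mom00 : mom 0 0 = 1) (mom10 : mom 1 0 = 0) (mom01 : mom 0 1 = 0).
Hypotheses (mom20 : mom 2 0 = 0) (mom02 : mom 0 2 = 0) (mom11 : mom 1 1 = 1).

Lemma wick_error (M : F) (a : n.-tuple G) : 1 <= M ->
  (forall p q, (p <= n)%N -> (q <= n)%N -> `|mom p q| <= M) ->
  `|mixed_moment mom (vars a) - pair_sum false (label_kernel circular_kernel) (zip w a) [::]|
    <= (bad_labels a)%:R * (M ^+ n + pair_sum false (fun _ _ => 1) w [::]).
Proof.
move=> M1 momM.
have kernel_le1 (u v : (J * G) * bool) : `|opposite F u v| <= 1 :> F.
  by rewrite ger0_norm ?ler0n // lern1 leq_b1.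
have -> : pair_sum false (label_kernel circular_kernel) (zip w a) [::] =
    pair_sum false (@opposite F _) (vars a) [::].
  rewrite /vars (pair_sum_map variable_of false (@opposite F _) (zip w a) [::]).
  congr pair_sum; apply/funext => u; apply/funext => v.
  by rewrite opposite_variables.
have [/existsP[v /eqP v1]|/existsPn not1] := boolP [exists v, mult (vars a) v == 1%N].
  rewrite (mixed_moment_single mom10 mom01 v1) (pair_sum_single _ v1) subr0 normr0.
  have M0 : 0 <= M := le_trans ler01 M1.
  by rewrite mulr_ge0 // addr_ge0 ?exprn_ge0 // pair_sum_ge0.
have [bad_a|good_a] := boolP (bad_labels a).
  rewrite mul1r; apply: le_trans (ler_normB _ _) _; apply: lerD.
    rewrite -{1}(size_vars a); apply: mixed_moment_bound => //.
    by move=> p q; rewrite size_vars; exact: momM.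
  apply: le_trans (pair_sum_norm _ _ _ kernel_le1) _.
  by rewrite (pair_sum1_size F false (vars a)) (pair_sum1_size F false w) size_vars.
rewrite (mixed_moment_wick mom00 mom10 mom01 mom20 mom02 mom11 (st := [::])) //.
  by rewrite subrr normr0 mul0r.
move=> v; rewrite leqNgt; apply: contra good_a => v3; apply/andP; split.
  by apply/existsP; exists v.
exact/forallP.
Qed.

(** The error has two sources: bad labellings, of which there are fewer than the
    normalization by a factor [r], and crossing pairings. *)
Theorem moment_estimate (M r : F) : 1 <= M ->
  (forall p q, (p <= n)%N -> (q <= n)%N -> `|mom p q| <= M) ->
  0 <= r -> r ^+ 2 = #|G|%:R ->
  `|r ^- n * (\sum_(a : n.-tuple G)
       ((\prod_(g <- a) g)%g == 1%g)%:R * mixed_moment mom (vars a))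
     - fock circular_kernel w [::]|
  <= (n ^ n)%:R * (M ^+ n + pair_sum false (fun _ _ => 1) w [::]) / r
     + (commuting_pairs G)%:R / #|G|%:R ^+ 2 * pair_sum false circular_kernel w [::].
Proof.
move=> M1 momM r_ge0 r2; have r_gt0 : 0 < r.
  rewrite lt_neqAle r_ge0 andbT eq_sym; apply/eqP => r0; move: r2.
  rewrite r0 expr0n => /esym/eqP; rewrite pnatr_eq0 -leqn0 leqNgt.
  by move/negP; apply; apply/card_gt0P; exists 1%g.
have r_ge1 : 1 <= r.
  rewrite -(@ler_pXn2r _ 2) ?nnegrE // expr1n r2 ler1n.
  by apply/card_gt0P; exists 1%g.
have rn_gt0 : 0 < r ^+ n by rewrite exprn_gt0.
set D := M ^+ n + _; have D_ge0 : 0 <= D.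
  by rewrite addr_ge0 ?exprn_ge0 ?pair_sum_ge0 // (le_trans ler01).
rewrite -(ler_pM2l rn_gt0) -{1}(ger0_norm (ltW rn_gt0)) -normrM mulrBr mulrA.
rewrite divff ?gt_eqF // mul1r.
set T := fun a : n.-tuple G => ((\prod_(g <- a) g)%g == 1%g)%:R : F.
set ps := fun a : n.-tuple G => pair_sum false (label_kernel circular_kernel) (zip w a) [::].
rewrite -[X in `|X - _|](subrK (\sum_(a : n.-tuple G) T a * ps a)) -addrA.
apply: le_trans (ler_normD _ _) _; rewrite mulrDr; apply: lerD; last first.
  apply: le_trans (wick_count _ _ r_ge0 r2) _ => //.
  by rewrite mulrCA.
rewrite -sumrB; apply: le_trans (ler_norm_sum _ _ _) _.
apply: (@le_trans _ _ (\sum_(a : n.-tuple G) (bad_labels a)%:R * D)).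
  apply: ler_sum => a _; rewrite -mulrBr normrM.
  apply: le_trans (_ : 1 * `|mixed_moment mom (vars a) - ps a| <= _).
    by rewrite ler_wpM2r // ger0_norm ?ler0n // /T lern1 leq_b1.
  by rewrite mul1r; exact: wick_error.
have -> : r ^+ n * ((n ^ n)%:R * D / r) = (n ^ n)%:R * (r ^+ n / r) * D by ring.
rewrite -mulr_suml; apply: ler_wpM2r => //.
have -> : \sum_(a : n.-tuple G) (bad_labels a)%:R = #|[set a | bad_labels a]%SET|%:R :> F.
  rewrite -sum1dep_card natr_sum [RHS]big_mkcond; apply: eq_bigr => a _.
  by case: ifP.
(* The empty word has no bad labelling, but the count would not show it. *)
have [n0|n_gt0] := posnP n.
  rewrite (_ : #|_| = 0%N) ?mulr_ge0 ?invr_ge0 ?exprn_ge0 //.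
  apply/eqP; rewrite cards_eq0; apply/eqP/setP => a; rewrite !inE.
  apply/negP => /andP[/existsP[v v3] _].
  by have := leq_trans v3 (count_size _ _); rewrite size_vars n0.
apply: (@le_trans _ _ (n ^ n * #|G| ^ (n.-1./2))%N%:R); first by rewrite ler_nat card_bad_labels.
rewrite natrM [(#|G| ^ _)%:R]natrX -r2 -exprM; apply: ler_wpM2l => //.
have -> : r ^+ n / r = r ^+ n.-1 by rewrite -{1}(prednK n_gt0) exprSr mulfK // gt_eqF.
by apply: ler_weXn2l => //; lia.
Qed.

End MomentEstimate.

(** * The proportion of commuting pairs and the Plancherel measure *)

Section Unitarization.
Variable (C : numClosedFieldType).

(** Diagonalize [H] in a unitary basis, then rescale by the inverse square roots
    of its eigenvalues, which are positive. *)
Lemma posdef_congr_id n (H : 'M[C]_n) :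
  H ^t* = H -> (forall u : 'rV_n, u != 0 -> 0 < (u *m H *m u ^t*) 0 0) ->
  exists2 B, B \in unitmx & B *m H *m B ^t* = 1%:M.
Proof.
move=> H_herm H_pos.
have /orthomx_spectralP H_diag : H \is normalmx.
  by apply/normalmxP; rewrite H_herm.
set U := spectralmx H in H_diag; set D := spectral_diag H in H_diag.
have U_unitary : U \is unitarymx := spectral_unitarymx H.
have UU : U *m U ^t* = 1%:M by apply/unitarymxP.
have UHU : U *m H *m U ^t* = diag_mx D.
  by rewrite H_diag invmx_unitary // !mulmxA UU mul1mx -mulmxA UU mulmx1.
have D_gt0 i : 0 < D 0 i.
  have -> : D 0 i = (row i U *m H *m (row i U) ^t*) 0 0.
    have -> : D 0 i = (diag_mx D) i i by rewrite mxE eqxx mulr1n.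
    rewrite -UHU -!row_mul tr_row map_col !mxE; apply: eq_bigr => k _.
    by rewrite !mxE.
  apply: H_pos; apply/eqP => Ui0.
  have := congr1 (fun M : 'M[C]_n => row i M) UU.
  rewrite row_mul Ui0 mul0mx row1 => /matrixP/(_ 0 i).
  by rewrite !mxE !eqxx => /esym/eqP; rewrite oner_eq0.
pose q := \row_i (sqrtC (D 0 i))^-1.
exists (diag_mx q *m U).
  rewrite unitmx_mul (unitarymx_unit U_unitary) andbT unitmxE det_diag unitfE.
  by apply/prodf_neq0 => i _; rewrite mxE invr_eq0 sqrtC_eq0 gt_eqF.
rewrite trmx_mul map_mxM !mulmxA -2!(mulmxA (diag_mx q)) UHU.
rewrite tr_diag_mx map_diag_mx mulmx_diag mulmx_diag.
apply/matrixP => i j; rewrite !mxE; congr (_ *+ _).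
have qR : (sqrtC (D 0 i))^-1 ^* = (sqrtC (D 0 i))^-1.
  by apply/CrealP; rewrite realV realE sqrtC_ge0 ltW.
rewrite [X in _ * X]qR mulrAC -invfM -expr2 sqrtCK mulVf //.
by rewrite gt_eqF.
Qed.

(** Weyl's averaging trick: the sum of [rG g *m (rG g) ^t*] over the group is
    positive definite and invariant, and a change of basis turns it into the
    identity. *)
Lemma repr_unitarizable (gT : finGroupType) (G : {group gT}) n
    (rG : mx_representation C G n) :
  exists2 rho : mx_representation C G n,
    mx_rsim rG rho & forall g, g \in G -> rho g \is unitarymx.
Proof.
pose H := \sum_(g in G) rG g *m (rG g) ^t*.
have H_herm : H ^t* = H.
  rewrite /H raddf_sum /= map_mx_sum; apply: eq_bigr => g _.
  by rewrite trmx_mul map_mxM trmxCK.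
have H_pos (u : 'rV_n) : u != 0 -> 0 < (u *m H *m u ^t*) 0 0.
  move=> u0; rewrite mulmx_sumr mulmx_suml summxE.
  have pos g : g \in G -> 0 < (u *m (rG g *m (rG g) ^t*) *m u ^t*) 0 0.
    move=> Gg; have := @dotmx_is_dotmx C n (u *m rG g).
    rewrite dotmxE trmx_mul map_mxM !mulmxA; apply.
    apply: contra u0 => /eqP ug0.
    by rewrite -[u](repr_mxK rG Gg) ug0 mul0mx.
  rewrite (bigD1 1%g) //= ltr_pwDl ?pos // sumr_ge0 // => g /andP[Gg _].
  exact/ltW/pos.
have rGH g : g \in G -> rG g *m H *m (rG g) ^t* = H.
  move=> Gg; rewrite mulmx_sumr mulmx_suml /H.
  rewrite [RHS](reindex_inj (mulgI g)) /=.
  apply: eq_big => [h|h Gh]; first by rewrite groupMl.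
  by rewrite repr_mxM // trmx_mul map_mxM !mulmxA.
have [B B_unit BHB] := posdef_congr_id H_herm H_pos.
exists (rconj_repr rG B_unit).
  apply: mx_rsim_sym; exists B => //; first by rewrite row_free_unit.
  by move=> g Gg; rewrite rconj_mxE mulmxKV.
move=> g Gg; apply/unitarymxP; rewrite rconj_mxE.
have H_def : invmx B *m (invmx B) ^t* = H.
  have Bt_unit : B ^t* \in unitmx by rewrite map_unitmx unitmx_tr.
  have -> : (invmx B) ^t* = invmx (B ^t*).
    by rewrite trmx_inv map_invmx.
  rewrite -[H](mulmxK Bt_unit) -[H *m _](mulKmx B_unit) (mulmxA B) BHB.
  by rewrite mulmx1.
rewrite !trmx_mul !map_mxM !mulmxA -(mulmxA _ (invmx B)) H_def.
by rewrite -(mulmxA B) -(mulmxA B) rGH.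
Qed.

End Unitarization.

Section UnitaryDualCount.
Variables (R : realType) (gT : finGroupType).
Let G : {group gT} := [set: gT]%G.
Let sG : irrType R[i] G := DecSocleType (regular_repr R[i] G).

Let char0G : pgroup.pgroup [pchar R[i]]^' G.
Proof. by apply/pgroup.pgroupP => p _; rewrite inE /= pchar_num. Qed.

(** Indexing classes by the components of the regular representation makes it
    possible to count them. *)
Definition unitary_class n (i : sG) : set (mx_representation R[i] G n) :=
  [set rho | irr_unitary_repr rho /\ irr_comp sG rho = i].

Lemma unitary_class_inh n i : irr_degree i = n ->
  exists rho, @unitary_class n i rho.
Proof.
move=> <-; have [rho sim_rho rho_unitary] := repr_unitarizable (irr_repr i).
exists rho; split; last first.
  by rewrite -(irr_comp_rsim_pchar sG char0G sim_rho) irr_reprK_pchar.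
split; first exact: mx_rsim_irr sim_rho (socle_irr i).
by move=> g; rewrite rho_unitary ?inE.
Qed.

(** Irreducible representations are similar when they have the same component in
    the regular representation, and each component occurs among the unitary
    ones by [repr_unitarizable]. *)
Lemma unitary_dual_image n :
  @unitary_dual R gT n = @unitary_class n @` [set i | irr_degree i = n].
Proof.
have classE rho : irr_unitary_repr rho ->
    [set rho' | irr_unitary_repr rho' /\ mx_rsim rho rho'] =
    @unitary_class n (irr_comp sG rho).
  move=> [irr_rho _]; apply/seteqP; split=> rho' [rho'_unitary] => [sim|same];
    split=> //; first exact/esym/irr_comp_rsim_pchar.
  apply: mx_rsim_trans (rsim_irr_comp_pchar sG char0G irr_rho) _.
  rewrite -same; apply: mx_rsim_sym; apply: rsim_irr_comp_pchar => //.
  by case: rho'_unitary.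
apply/seteqP; split=> [K [rho rho_unitary ->]|_ [i ni <-]].
  exists (irr_comp sG rho); last by rewrite classE.
  have [irr_rho _] := rho_unitary.
  by have := mxrank_rsim (rsim_irr_comp_pchar sG char0G irr_rho).
have [rho [rho_unitary rho_i]] := unitary_class_inh ni.
by exists rho => //; rewrite classE // rho_i.
Qed.

Lemma num_irrE n : num_irr R gT n = #|[pred i : sG | irr_degree i == n]|.
Proof.
have eqD : [set i : sG | irr_degree i = n] = [set` [pred i : sG | irr_degree i == n]].
  by apply/seteqP; split=> i /eqP.
have finD : finite_set [set i : sG | irr_degree i = n] by [].
rewrite /num_irr unitary_dual_image fset_set_image // card_in_imfset /=.
  rewrite cardE; apply/eqP; rewrite -uniq_size_uniq ?fset_uniq ?enum_uniq //.
  by move=> i; rewrite mem_enum in_fset_set //; apply/idP/idP; rewrite !inE => /eqP.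
move=> i j; rewrite !in_fset_set // !inE => ni nj eqK.
have [rho rho_i] := unitary_class_inh ni.
have := rho_i; rewrite eqK => -[_ <-].
by have [_ ->] := rho_i.
Qed.

(** Over an algebraically closed field of characteristic 0 there are as many
    irreducible representations as conjugacy classes. *)
Lemma sum_num_irr :
  (\sum_(n < #|gT|) num_irr R gT n.+1)%N = #|classes G|.
Proof.
have <- : #|sG| = #|classes G|.
  by apply: card_irr_pchar => //; exact: group_closure_closed_field.
have deg_le (i : sG) : (irr_degree i <= #|gT|)%N.
  by rewrite irr_degreeE -[#|gT|]cardsT rank_leq_row.
rewrite (eq_bigr (fun n : 'I__ => \sum_(i : sG) (irr_degree i == n.+1))%N); last first.
  by move=> n _; rewrite num_irrE -sum1_card big_mkcond.
rewrite exchange_big /= -[RHS]sum1_card; apply: eq_big => // i _.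
have deg_gt0 := irr_degree_gt0 i.
have lt_deg : ((irr_degree i).-1 < #|gT|)%N by rewrite prednK.
rewrite (bigD1 (Ordinal lt_deg)) //= prednK // eqxx big1 // => n.
rewrite -val_eqE /= => ni; case: eqP => // di.
by rewrite di eqxx in ni.
Qed.

Lemma num_irr_gt n : (#|gT| < n)%N -> num_irr R gT n = 0%N.
Proof.
move=> gt_n; rewrite num_irrE; apply/eqP/pred0P => i /=.
apply/eqP => ni; move: gt_n; rewrite -ni ltnNge => /negP; apply.
by rewrite irr_degreeE -[#|gT|]cardsT rank_leq_row.
Qed.

End UnitaryDualCount.

Section InverseSquare.
Variable R : realType.

(** The density that cancels the square of the dimension in the Plancherel
    weights; it is the test function for the weak convergence. *)
Definition inv_square (x : Zbar) : R :=
  if x is Some k then ((sval k) ^ 2)%:R^-1 else 0.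

Lemma inv_square_ge0 x : 0 <= inv_square x.
Proof. by case: x => //= k; rewrite invr_ge0. Qed.

Lemma inv_square_le1 x : inv_square x <= 1.
Proof.
case: x => //= -[k /=]; rewrite inE /= => k0.
by rewrite invf_le1 ?ler1n ?ltr0n expn_gt0 k0.
Qed.

Lemma Zpos_open (V : set Zpos) : open V.
Proof.
exists (set_val @` V); first exact: discrete_open.
apply/seteqP; split=> [k [k' Vk' /val_inj <-] //|k Vk].
by exists k.
Qed.

Lemma Zpos_compact_le n : compact [set k : Zpos | (sval k <= n)%N].
Proof.
apply: finite_compact; apply: (@sub_finite_set _ _ (Zpos_succ @` `I_n)).
  move=> [k k_pos]; have k0 : (0 < k)%N by have := k_pos; rewrite inE.
  rewrite /= => kn; exists k.-1; first by rewrite /= prednK.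
  by apply/val_inj; rewrite /= prednK.
by apply: finite_image; exact: finite_II.
Qed.

(** At infinity: all but finitely many integers have a small inverse square, and
    finite sets are compact. *)
Lemma inv_square_continuous : continuous inv_square.
Proof.
move=> [k|] U fU.
  apply: (@open_nbhs_nbhs _ k); split; first exact: Zpos_open.
  exact: nbhs_singleton fU.
have [e /= e0 eU] := (nbhs_ballP _ _).1 fU.
exists [set k : Zpos | (sval k <= Num.truncn e^-1)%N].
  split; first exact: Zpos_compact_le.
  by rewrite -[X in closed X]setCK; apply: open_closedC; exact: Zpos_open.
move=> _ [[k /= nk <-]|->] /=; last exact: nbhs_singleton fU.
have ltk : (Num.truncn e^-1 < sval k)%N by rewrite ltnNge; apply/negP.
apply: eU; rewrite /ball /= sub0r normrN.
have k0 : (0 < sval k)%N := leq_ltn_trans (leq0n _) ltk.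
rewrite ger0_norm ?invr_ge0 // invf_plt ?posrE ?ltr0n ?expn_gt0 ?k0 //.
apply: (lt_le_trans (truncnS_gt _)).
by rewrite ler_nat (leq_trans ltk) // -{1}[sval k]expn1 leq_pexp2l.
Qed.

(** Sets without the point at infinity are open, and the others are closed. *)
Lemma measurable_Zbar (B : set (Borel Zbar)) : measurable B.
Proof.
have open_some (V : set Zpos) : measurable (Some @` V : set (Borel Zbar)).
  apply: sub_sigma_algebra; apply: one_point_compactification_open_some.
  exact: Zpos_open.
have [BN|BN] := pselect (B None); last first.
  suff -> : B = Some @` [set k | B (Some k)] by [].
  by apply/seteqP; split=> [[k Bk|//]|_ [k Bk <-] //]; exists k.
suff -> : B = ~` (Some @` [set k | ~ B (Some k)]) by apply: measurableC.
apply/seteqP; split=> [x Bx [k Bk kx]|[k nBk|//]]; first by apply: Bk; rewrite kx.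
by apply: contrapT => Bk; apply: nBk; exists k.
Qed.

(** Each irreducible class has weight 1/|G| for this density, so the integral is
    the number of conjugacy classes divided by |G|. *)
Lemma integral_inv_square (gT : finGroupType) :
  Rintegral (plancherel_dim R gT) [set: Borel Zbar] inv_square =
  (commuting_pairs gT)%:R / (#|gT|%:R ^+ 2).
Proof.
have mf : measurable_fun [set: Borel Zbar] (fun x : Borel Zbar => (inv_square x)%:E).
  by move=> _ B _; exact: measurable_Zbar.
have f0 x : [set: Borel Zbar] x -> (0 <= (inv_square x)%:E)%E.
  by move=> _; rewrite lee_fin inv_square_ge0.
rewrite /Rintegral /plancherel_dim ge0_integral_measure_series //.
rewrite (eq_eseriesr (g := fun n => ((num_irr R gT n.+1)%:R / #|gT|%:R : R)%:E)); last first.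
  move=> n _; rewrite ge0_integral_mscale // integral_dirac // diracT mul1e.
  rewrite -EFinM /=; congr (_%:E).
  by rewrite mulrC !mulrA mulVf ?mul1r 1?mulrC // pnatr_eq0 expn_eq0.
(* Only dimensions up to |G| occur, so that the series is a finite sum. *)
rewrite (nneseries_split 0 #|gT|); last by move=> k _; rewrite lee_fin divr_ge0.
rewrite eseries0; last first.
  by move=> k gk _; rewrite num_irr_gt ?mul0r.
rewrite adde0 add0n big_mkord sumEFin /= -mulr_suml -natr_sum sum_num_irr.
rewrite commuting_pairs_classes natrM expr2 invfM mulrA mulfK //.
by rewrite pnatr_eq0 -lt0n; apply/card_gt0P; exists 1%g.
Qed.

End InverseSquare.

Lemma commuting_pairs_vanish (R : realType) (gT : nat -> finGroupType) :
  weak_cvg (fun N => plancherel_dim R (gT N)) (dirac (None : Borel Zbar)) ->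
  (fun N => (commuting_pairs (gT N))%:R / (#|gT N|%:R ^+ 2) : R) @ \oo --> (0 : R).
Proof.
move=> /(_ (@inv_square R) (@inv_square_continuous R)) wc.
have bf : bounded_fun (@inv_square R).
  exists 1; split => // M M1 x _ /=.
  by rewrite ger0_norm ?inv_square_ge0 // (le_trans (inv_square_le1 _ _)) // ltW.
have := wc bf; rewrite {2}/Rintegral integral_dirac; last first.
- by move=> _ B _; exact: measurable_Zbar.
- exact: measurableT.
rewrite diracT mul1e /=.
by under eq_fun do rewrite integral_inv_square.
Qed.

(** * Product rule for independent random variables *)

Section WeightedIntegral.
Import HBNNSimple.
Local Open Scope ereal_scope.
Context d dY (T : measurableType d) (Y : measurableType dY) (R : realType).
Variables (mu : {measure set T -> \bar R}) (Z : T -> Y) (W : T -> R).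
Hypotheses (mZ : measurable_fun setT Z) (mW : measurable_fun setT W).
Hypothesis W_ge0 : forall w, (0 <= W w)%R.

Definition weighted_integral (g : Y -> R) : \bar R :=
  \int[mu]_w (g (Z w) * W w)%:E.

Lemma measurable_weighted (g : Y -> R) : measurable_fun setT g ->
  measurable_fun setT (fun w => (g (Z w) * W w)%:E).
Proof.
move=> mg; apply/measurable_EFinP; apply: measurable_funM => //.
exact: measurableT_comp.
Qed.

Lemma weighted_integral_lim (g : Y -> R) (mg : measurable_fun setT (EFin \o g)) :
  (forall y, (0 <= g y)%R) ->
  weighted_integral g =
  limn (fun n => weighted_integral (nnsfun_approx measurableT mg n)).
Proof.
move=> g0; pose f_ := nnsfun_approx measurableT mg.
rewrite /weighted_integral -monotone_convergence //.
- apply: eq_integral => w _; apply/esym/cvg_lim => //.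
  rewrite EFinM; under eq_fun do rewrite EFinM.
  apply: cvgeZr => //.
  by apply: (cvg_nnsfun_approx measurableT mg) => // y _ /=; rewrite lee_fin.
- by move=> n; apply: measurable_weighted.
- by move=> n w _; rewrite lee_fin mulr_ge0.
- move=> w _ a b ab; rewrite lee_fin ler_wpM2r //.
  exact/lefP/nd_nnsfun_approx.
Qed.

Lemma weighted_integral_nnsfun (f : {nnsfun Y >-> R}) :
  weighted_integral f =
  \sum_(k \in range f) (k%:E * weighted_integral \1_(f @^-1` [set k])).
Proof.
rewrite /weighted_integral.
have term_ge0 k w : range f k -> 0 <= (k * (\1_(f @^-1` [set k]) (Z w) * W w))%:E.
  by move=> [y _ <-]; rewrite lee_fin !mulr_ge0.
have mterm k : measurable_fun setT (fun w => (\1_(f @^-1` [set k]) (Z w) * W w)%:E).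
  exact: measurable_weighted.
transitivity (\int[mu]_w \sum_(k \in range f)
    ((Num.max k 0)%R * (\1_(f @^-1` [set k]) (Z w) * W w))%:E).
  apply: eq_integral => w _; rewrite fsumEFin //; congr (_%:E).
  rewrite {1}fimfunE mulr_fsuml //.
  apply: eq_fsbigr => k; rewrite inE => -[y _ <-].
  by rewrite max_l // mulrA.
rewrite ge0_integral_fsum //.
- apply: eq_fsbigr => k; rewrite inE => -[y _ <-].
  rewrite max_l // -ge0_integralZl_EFin //.
  by move=> w _; rewrite lee_fin mulr_ge0.
- move=> k; under eq_fun do rewrite EFinM.
  exact: measurable_funeM.
- by move=> k w _; rewrite lee_fin !mulr_ge0 // le_max lexx orbT.
Qed.

End WeightedIntegral.

Section WeightedIntegralExt.
Import HBNNSimple.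

(** Indicators determine the integral by linearity and monotone convergence.
    The weights [W1] and [W2] serve to replace one factor of a product at a
    time; with constant weights the statement is that the law determines
    expectations. *)
Lemma weighted_integral_ext d1 d2 dY (T1 : measurableType d1) (T2 : measurableType d2)
    (Y : measurableType dY) (R : realType)
    (mu1 : {measure set T1 -> \bar R}) (mu2 : {measure set T2 -> \bar R})
    (Z1 : T1 -> Y) (Z2 : T2 -> Y) (W1 : T1 -> R) (W2 : T2 -> R) :
  measurable_fun setT Z1 -> measurable_fun setT Z2 ->
  measurable_fun setT W1 -> measurable_fun setT W2 ->
  (forall w, 0 <= W1 w) -> (forall w, 0 <= W2 w) ->
  (forall B, measurable B ->
    weighted_integral mu1 Z1 W1 \1_B = weighted_integral mu2 Z2 W2 \1_B) ->
  forall g : Y -> R, measurable_fun setT g -> (forall y, 0 <= g y) ->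
  weighted_integral mu1 Z1 W1 g = weighted_integral mu2 Z2 W2 g.
Proof.
move=> mZ1 mZ2 mW1 mW2 W1_ge0 W2_ge0 eq_ind g mg g0.
have mEg : measurable_fun setT (EFin \o g) by exact/measurable_EFinP.
rewrite !(weighted_integral_lim _ _ _ _ mEg) //.
congr (limn _); apply/funext => n.
rewrite !weighted_integral_nnsfun //; apply: eq_fsbigr => k _.
rewrite eq_ind //; apply: measurable_funPTI; exact: measurable_set1.
Qed.

End WeightedIntegralExt.

Section IndependentProduct.
Context d (T : measurableType d) (R : realType) (P : probability T R).
Variables (I : finType) (X : I -> T -> R[i]).
Hypothesis X_rv : forall i, complex_rv (X i).
Hypothesis X_indep : mutually_independent P X.

Definition expect (i : I) (g : R * R -> R) : \bar R :=
  (\int[P]_w (g (RIm (X i w)))%:E)%E.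

Lemma expect_ge0 i g : (forall y, 0 <= g y) -> (0 <= expect i g)%E.
Proof. by move=> g0; apply: integral_ge0 => w _; rewrite lee_fin. Qed.

Lemma expect_indic i B : measurable B ->
  expect i \1_B = P ((@RIm R \o X i) @^-1` B).
Proof.
move=> mB; have mpre : measurable ((@RIm R \o X i) @^-1` B).
  by rewrite -[_ @^-1` _]setTI; exact: X_rv.
rewrite -[P _]mul1e -[X in (_ * P X)%E]setIT -integral_indic // ?mul1e.
by [].
Qed.

Lemma measurable_prod_comp (f : I -> R * R -> R) (p : pred I) :
  (forall i, measurable_fun setT (f i)) ->
  measurable_fun setT (fun w => \prod_(i | p i) f i (RIm (X i w))).
Proof.
move=> mf; under eq_fun do rewrite -big_filter.
apply: measurable_prod => i _.
by apply: measurableT_comp => //; exact: X_rv.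
Qed.

(** Independence is the case where all factors are indicators. General
    nonnegative factors are introduced one at a time: as a function of the new
    factor both sides are integrals, and they agree on indicators by
    induction. *)
Lemma independent_prod_ge0 (s : seq I) (f : I -> R * R -> R) :
  (forall i, measurable_fun setT (f i)) -> (forall i y, 0 <= f i y) ->
  (forall i, expect i (f i) < +oo)%E ->
  (forall i, i \notin s -> exists2 B, measurable B & f i = \1_B) ->
  (\int[P]_w (\prod_i f i (RIm (X i w)))%:E)%E =
  (\prod_i fine (expect i (f i)))%:E.
Proof.
elim: s f => [|k s IH] f mf f0 f_fin f_ind.
  have [B B_f] : {B : I -> set (R * R) & forall i, measurable (B i) /\ f i = \1_(B i)}.
    apply: (@choice _ _ (fun i B => measurable B /\ f i = \1_B)) => i.
    by have [B mB fB] := f_ind i isT; exists B.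
  have B_m i : measurable (B i) by case: (B_f i).
  have mX i : measurable ((@RIm R \o X i) @^-1` B i).
    by rewrite -[_ @^-1` _]setTI; exact: X_rv.
  have := X_indep [set: I]%SET B_m.
  have -> : \bigcap_(i in [set` [set: I]%SET]) (@RIm R \o X i) @^-1` B i =
      \bigcap_i (@RIm R \o X i) @^-1` B i.
    by apply/seteqP; split=> w Aw i _; apply: Aw; rewrite //= inE.
  have -> : (\prod_(i in [set: I]%SET) P ((@RIm R \o X i) @^-1` B i))%E =
      (\prod_i fine (expect i (f i)))%:E.
    rewrite -prodEFin; apply: eq_big => [i|i _]; first by rewrite inE.
    by case: (B_f i) => _ ->; rewrite expect_indic // fineK // fin_num_measure.
  move=> <-; set A := \bigcap_i _.
  have mA : measurable A by apply: fin_bigcap_measurable.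
  rewrite -[RHS]mul1e -[X in (_ * P X)%E]setIT -integral_indic // mul1e.
  apply: eq_integral => w _; congr (_%:E); rewrite indicE.
  have [Aw|nAw] := pselect (A w).
    rewrite mem_set // big1 // => i _; case: (B_f i) => _ ->.
    by rewrite indicE mem_set //; exact: Aw.
  rewrite memNset //; have [i nBi] : exists i, ~ B i (RIm (X i w)).
    by apply: contrapT => nB; apply: nAw => i _; apply: contrapT => nBi; apply: nB; exists i.
  by rewrite (bigD1 i) //=; case: (B_f i) => _ ->; rewrite indicE memNset // mul0r.
(* All factors but the new one are frozen in the weight [W]. *)
pose W w := \prod_(i | i != k) f i (RIm (X i w)).
have mX i : measurable_fun setT (@RIm R \o X i) by exact: X_rv.
have mW : measurable_fun setT W by exact: measurable_prod_comp.
have W0 w : 0 <= W w by apply: prodr_ge0.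
pose C := \prod_(i | i != k) fine (expect i (f i)).
have C0 : 0 <= C by apply: prodr_ge0 => i _; rewrite fine_ge0 // expect_ge0.
have E_fin i (g : R * R -> R) : (forall y, 0 <= g y) ->
    (expect i g < +oo)%E -> expect i g \is a fin_num.
  by move=> g0 gfin; rewrite ge0_fin_numE // expect_ge0.
have constE (g : R * R -> R) : measurable_fun setT g -> (forall y, 0 <= g y) ->
    (expect k g < +oo)%E ->
    weighted_integral P (@RIm R \o X k) (fun _ => C) g = (fine (expect k g) * C)%:E.
  move=> mg g0 g_fin; rewrite EFinM fineK ?E_fin // muleC /expect -ge0_integralZl_EFin //.
  - by apply: eq_integral => w _; rewrite -EFinM mulrC.
  - by move=> w _; rewrite lee_fin.
  - by apply/measurable_EFinP; apply: measurableT_comp => //; exact: X_rv.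
transitivity (weighted_integral P (@RIm R \o X k) W (f k)).
  by apply: eq_integral => w _; rewrite (bigD1 k).
rewrite [in RHS](bigD1 k) //= -constE //.
apply: weighted_integral_ext => // B mB.
have B_fin : (expect k \1_B < +oo)%E.
  rewrite expect_indic // (le_lt_trans (probability_le1 _ _)) ?ltry //.
  by rewrite -[_ @^-1` _]setTI; exact: X_rv.
rewrite constE //; pose f' i := if i == k then \1_B else f i.
transitivity (\int[P]_w (\prod_i f' i (RIm (X i w)))%:E)%E.
  apply: eq_integral => w _; rewrite (bigD1 k) //= /f' eqxx; congr (_ * _)%:E.
  by apply: eq_bigr => i /negbTE ->.
rewrite IH.
- rewrite (bigD1 k) //= /f' eqxx; congr (_ * _)%:E.
  by apply: eq_bigr => i /negbTE ->.
- by move=> i; rewrite /f'; case: eqP.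
- by move=> i y; rewrite /f'; case: eqP.
- by move=> i; rewrite /f'; case: eqP => [->|].
move=> i i_s; rewrite /f'; have [ik|ik] := eqVneq i k; first by exists B.
by apply: f_ind; rewrite inE negb_or ik.
Qed.

End IndependentProduct.

(** * Complex expectations *)

Section ComplexExpectation.
Context d (T : measurableType d) (R : realType) (P : probability T R).
Implicit Types (Y Z : T -> R[i]) (h : T -> R).

Definition cintegrable Y :=
  P.-integrable setT (fun w => (complex.Re (Y w))%:E) /\
  P.-integrable setT (fun w => (complex.Im (Y w))%:E).

Lemma cintegrableD Y Z : cintegrable Y -> cintegrable Z ->
  cintegrable (fun w => Y w + Z w) /\
  cexp P (fun w => Y w + Z w) = cexp P Y + cexp P Z.
Proof.
have ReD (u v : R[i]) : complex.Re (u + v) = complex.Re u + complex.Re v.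
  by case: u; case: v.
have ImD (u v : R[i]) : complex.Im (u + v) = complex.Im u + complex.Im v.
  by case: u; case: v.
move=> [rY iY] [rZ iZ]; split; first split.
- by under eq_fun do rewrite ReD EFinD; exact: integrableD.
- by under eq_fun do rewrite ImD EFinD; exact: integrableD.
rewrite /cexp; under [in X in Complex X _]eq_Rintegral do rewrite ReD.
under [in X in Complex _ X]eq_Rintegral do rewrite ImD.
by rewrite !RintegralD.
Qed.

Lemma cintegrableZ (k : R[i]) Y : cintegrable Y ->
  cintegrable (fun w => k * Y w) /\ cexp P (fun w => k * Y w) = k * cexp P Y.
Proof.
have ReM (u v : R[i]) : complex.Re (u * v) =
    complex.Re u * complex.Re v - complex.Im u * complex.Im v.
  by case: u; case: v.
have ImM (u v : R[i]) : complex.Im (u * v) =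
    complex.Re u * complex.Im v + complex.Im u * complex.Re v.
  by case: u; case: v.
have intZ (a : R) h : P.-integrable setT (fun w => (h w)%:E) ->
    P.-integrable setT (fun w => (a * h w)%:E).
  by move=> ih; under eq_fun do rewrite EFinM; exact: integrableZl.
move=> [rY iY]; split; first split.
- under eq_fun do rewrite ReM EFinB; apply: integrableB => //; exact: intZ.
- under eq_fun do rewrite ImM EFinD; apply: integrableD => //; exact: intZ.
rewrite /cexp; under [in X in Complex X _]eq_Rintegral do rewrite ReM.
under [in X in Complex _ X]eq_Rintegral do rewrite ImM.
rewrite RintegralB ?RintegralD ?RintegralZl //; try exact: intZ.
by case: k.
Qed.

Lemma Rintegral_cst0 : Rintegral P setT (fun _ => 0) = 0 :> R.
Proof. by rewrite /Rintegral integral0. Qed.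

Lemma cexp_sum (I : Type) (s : seq I) (k : I -> R[i]) (Y : I -> T -> R[i]) :
  (forall i, cintegrable (Y i)) ->
  cintegrable (fun w => \sum_(i <- s) k i * Y i w) /\
  cexp P (fun w => \sum_(i <- s) k i * Y i w) = \sum_(i <- s) k i * cexp P (Y i).
Proof.
move=> iY; elim: s => [|i s [IH1 IH2]].
  rewrite big_nil; under eq_fun do rewrite big_nil.
  split; first by split; exact: integrable0.
  by rewrite /cexp /= Rintegral_cst0.
rewrite big_cons -IH2; under eq_fun do rewrite big_cons.
have [kY1 kY2] := cintegrableZ (k i) (iY i).
by have [Y1 Y2] := cintegrableD kY1 IH1; rewrite Y2 kY2.
Qed.

Lemma cexp_real h : measurable_fun setT h -> (forall w, 0 <= h w) ->
  (\int[P]_w (h w)%:E < +oo)%E ->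
  cintegrable (fun w => (h w)%:C%C) /\
  cexp P (fun w => (h w)%:C%C) = (fine (\int[P]_w (h w)%:E)%E)%:C%C.
Proof.
move=> mh h0 h_fin; split; last by rewrite /cexp /= Rintegral_cst0.
split; last exact: integrable0.
apply/integrableP; split; first exact/measurable_EFinP.
by under eq_integral do rewrite /= ger0_norm //.
Qed.

End ComplexExpectation.

Section Quadrants.
Variable R : realType.

(** The four nonnegative functions through which a complex number is
    [quadrant 0 z + i * quadrant 1 z - quadrant 2 z - i * quadrant 3 z]. *)
Definition quadrant (t : 'I_4) (z : R[i]) : R :=
  match val t with
  | 0%N => Num.max (complex.Re z) 0
  | 1%N => Num.max (complex.Im z) 0
  | 2%N => Num.max (- complex.Re z) 0
  | _ => Num.max (- complex.Im z) 0
  end.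

Lemma quadrant_ge0 t z : 0 <= quadrant t z.
Proof. by rewrite /quadrant; case: (val t) => [|[|[|?]]]; rewrite le_max lexx orbT. Qed.

Lemma quadrant_sum (z : R[i]) : z = \sum_(t < 4) 'i%C ^+ t * (quadrant t z)%:C%C.
Proof.
rewrite !big_ord_recl big_ord0 /= /quadrant /=.
have posneg (x : R) : x = Num.max x 0 - Num.max (- x) 0.
  case/orP: (le_total 0 x) => x0.
    by rewrite max_l // max_r ?oppr_le0 // subr0.
  by rewrite max_r // max_l ?oppr_ge0 // opprK add0r.
rewrite /bump /= !add1n expr0 mul1r expr1 addr0 [_ ^+ 3]exprS !sqr_i mulrN1.
rewrite {1}[z]complexE {1}(posneg (complex.Re z)) {1}(posneg (complex.Im z)).
by rewrite !rmorphB /=; ring.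
Qed.

Lemma quadrant_le_norm t (z : R[i]) : quadrant t z <= complex.Re `|z|.
Proof.
have Re_norm : complex.Re `|z| = Num.sqrt (complex.Re z ^+ 2 + complex.Im z ^+ 2) by case: z.
have le_re (x y : R) : Num.max x 0 <= Num.sqrt (x ^+ 2 + y ^+ 2).
  rewrite ge_max sqrtr_ge0 andbT (le_trans (ler_norm x)) // -sqrtr_sqr ler_sqrt.
    by rewrite lerDl sqr_ge0.
  by rewrite addr_ge0 ?sqr_ge0.
rewrite Re_norm /quadrant; case: (val t) => [|[|[|?]]] //.
- by rewrite addrC.
- by rewrite -[complex.Re z ^+ 2]sqrrN.
- by rewrite -[complex.Im z ^+ 2]sqrrN addrC.
Qed.

Definition of_pair (y : R * R) : R[i] := (y.1 +i* y.2)%C.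

Lemma of_pairK z : of_pair (RIm z) = z. Proof. by case: z. Qed.

End Quadrants.

Section ComplexMeasurable.
Context d (T : measurableType d) (R : realType).
Implicit Types F : T -> R[i].

Definition cmeasurable F :=
  measurable_fun setT (fun y => complex.Re (F y)) /\
  measurable_fun setT (fun y => complex.Im (F y)).

Lemma cmeasurable_quadrant F t : cmeasurable F ->
  measurable_fun setT (fun y => quadrant t (F y)).
Proof.
move=> [mRe mIm]; rewrite /quadrant; case: (val t) => [|[|[|?]]];
  apply: measurable_maxr => //; exact: measurableT_comp.
Qed.

Lemma cmeasurable_norm F : cmeasurable F ->
  measurable_fun setT (fun y => complex.Re `|F y|).
Proof.
move=> [mRe mIm]; under eq_fun do rewrite normc_def.
apply: measurableT_comp; first exact: continuous_measurable_fun (@sqrt_continuous R).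
by apply: measurable_funD; apply: measurable_funX.
Qed.

Lemma cexp_quadrant (P : probability T R) F : cmeasurable F ->
  (\int[P]_w (complex.Re `|F w|)%:E < +oo)%E ->
  [/\ forall t, (\int[P]_w (quadrant t (F w))%:E < +oo)%E, cintegrable P F
    & cexp P F =
      \sum_(t < 4) 'i%C ^+ t * (fine (\int[P]_w (quadrant t (F w))%:E)%E)%:C%C].
Proof.
move=> mF F_fin.
have q_fin t : (\int[P]_w (quadrant t (F w))%:E < +oo)%E.
  apply: le_lt_trans F_fin; apply: ge0_le_integral => //.
  - by move=> w _; rewrite lee_fin quadrant_ge0.
  - exact/measurable_EFinP/cmeasurable_quadrant.
  - exact/measurable_EFinP/cmeasurable_norm.
  - by move=> w _; rewrite lee_fin quadrant_le_norm.
have int_q t := cexp_real (cmeasurable_quadrant t mF) (fun w => quadrant_ge0 t (F w)) (q_fin t).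
have [iF cF] := cexp_sum (index_enum 'I_4) (fun t : 'I_4 => 'i%C ^+ t) (fun t => (int_q t).1).
have FE : (fun w => \sum_(t < 4) 'i%C ^+ t * (quadrant t (F w))%:C%C) = F.
  by apply/funext => w; rewrite -quadrant_sum.
rewrite {}FE in iF cF; split=> //; rewrite cF.
by apply: eq_bigr => t _; rewrite (int_q t).2.
Qed.

End ComplexMeasurable.

Lemma cmeasurable_comp d (T : measurableType d) (R : realType) (X : T -> R[i])
    (f : R[i] -> R[i]) : complex_rv X -> cmeasurable (f \o @of_pair R) ->
  cmeasurable (fun w => f (X w)).
Proof.
move=> mX [mRe mIm].
by split; under eq_fun do rewrite -(of_pairK (X _)); [move: mRe|move: mIm] => mF;
  exact: measurableT_comp mF mX.
Qed.

Section IndependentComplex.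
Context d (T : measurableType d) (R : realType) (P : probability T R).
Variables (I : finType) (X : I -> T -> R[i]).
Hypothesis X_rv : forall i, complex_rv (X i).
Hypothesis X_indep : mutually_independent P X.

(** Expanding every factor over its quadrants reduces the product rule to
    nonnegative functions. *)
Theorem independent_cexp (f : I -> R[i] -> R[i]) :
  (forall i, cmeasurable (f i \o @of_pair R)) ->
  (forall i, (\int[P]_w (complex.Re `|f i (X i w)|)%:E < +oo)%E) ->
  cintegrable P (fun w => \prod_i f i (X i w)) /\
  cexp P (fun w => \prod_i f i (X i w)) = \prod_i cexp P (fun w => f i (X i w)).
Proof.
move=> mf f_fin.
pose g i (t : 'I_4) (y : R * R) := quadrant t (f i (of_pair y)).
have mg i t : measurable_fun setT (g i t) by exact: (cmeasurable_quadrant t (mf i)).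
have g0 i t y : 0 <= g i t y by exact: quadrant_ge0.
have mX i : measurable_fun setT (@RIm R \o X i) by exact: X_rv.
have mfX i : cmeasurable (fun w => f i (X i w)) by exact: cmeasurable_comp.
have g_fin i t : (expect P X i (g i t) < +oo)%E.
  have [+ _ _] := cexp_quadrant (mfX i) (f_fin i) => /(_ t).
  by congr (_ < _)%E; apply: eq_integral => w _; rewrite /g of_pairK.
have cexp_f i : cexp P (fun w => f i (X i w)) =
    \sum_(t < 4) 'i%C ^+ t * (fine (expect P X i (g i t)))%:C%C.
  have [_ _ ->] := cexp_quadrant (mfX i) (f_fin i).
  apply: eq_bigr => t _; congr (_ * (fine _)%:C%C).
  by apply: eq_integral => w _; rewrite /g of_pairK.
pose G (tau : {ffun I -> 'I_4}) w := \prod_i g i (tau i) (RIm (X i w)).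
have int_prod tau := independent_prod_ge0 (P := P) X_rv X_indep (s := enum I)
  (f := fun i => g i (tau i)) (fun i => mg i (tau i)) (fun i => g0 i (tau i))
  (fun i => g_fin i (tau i)).
have intG tau : cintegrable P (fun w => (G tau w)%:C%C) /\
    cexp P (fun w => (G tau w)%:C%C) =
    (\prod_i fine (expect P X i (g i (tau i))))%:C%C.
  have G_int : (\int[P]_w (G tau w)%:E)%E = (\prod_i fine (expect P X i (g i (tau i))))%:E.
    by apply: int_prod => i; rewrite mem_enum.
  have mG : measurable_fun setT (G tau).
    exact: (measurable_prod_comp X_rv predT (fun i => mg i (tau i))).
  have G0 w : 0 <= G tau w by apply: prodr_ge0.
  have G_fin : (\int[P]_w (G tau w)%:E < +oo)%E by rewrite G_int ltry.
  by have [iG eG] := cexp_real mG G0 G_fin; rewrite eG G_int.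
have prodE : (fun w => \prod_i f i (X i w)) =
    (fun w => \sum_(tau : {ffun I -> 'I_4}) (\prod_i 'i%C ^+ tau i) * (G tau w)%:C%C).
  apply/funext => w.
  under eq_bigr do rewrite [f _ _]quadrant_sum.
  rewrite bigA_distr_bigA; apply: eq_bigr => tau _.
  rewrite big_split rmorph_prod; congr (_ * _).
  by apply: eq_bigr => i _; rewrite /g of_pairK.
have [iS S] := cexp_sum (index_enum {ffun I -> 'I_4})
  (fun tau : {ffun I -> 'I_4} => \prod_i 'i%C ^+ tau i) (fun tau => (intG tau).1).
rewrite prodE; split=> //; rewrite S.
under [RHS]eq_bigr do rewrite cexp_f.
rewrite bigA_distr_bigA; apply: eq_bigr => tau _.
by rewrite (intG tau).2 rmorph_prod -big_split.
Qed.

End IndependentComplex.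

(** * Expectations of words in independent copies *)

Section IndependentCopies.
Context d0 (T0 : measurableType d0) (R : realType) (P0 : probability T0 R).
Variable xi : T0 -> R[i].
Hypotheses (xi_rv : complex_rv xi).
Hypothesis xi_moments : forall k, (abs_moment P0 xi k < +oo)%E.

Definition monomial (p q : nat) (z : R[i]) : R[i] := z ^+ p * z^* ^+ q.

Definition star_moment (p q : nat) : R[i] := cexp P0 (fun w => monomial p q (xi w)).

Lemma cmeasurable_monomial p q : cmeasurable (monomial p q \o @of_pair R).
Proof.
have mM (F G : R * R -> R[i]) : cmeasurable F -> cmeasurable G ->
    cmeasurable (fun y => F y * G y).
  move=> [rF iF] [rG iG].
  have re y : complex.Re (F y * G y) =
      complex.Re (F y) * complex.Re (G y) - complex.Im (F y) * complex.Im (G y).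
    by case: (F y); case: (G y).
  have im y : complex.Im (F y * G y) =
      complex.Re (F y) * complex.Im (G y) + complex.Im (F y) * complex.Re (G y).
    by case: (F y); case: (G y).
  split; [under eq_fun do rewrite re|under eq_fun do rewrite im].
    by apply: measurable_funB; apply: measurable_funM.
  by apply: measurable_funD; apply: measurable_funM.
have m1 : cmeasurable (fun _ : R * R => 1 : R[i]) by split; exact: measurable_cst.
have mX (F : R * R -> R[i]) n : cmeasurable F -> cmeasurable (fun y => F y ^+ n).
  move=> mF; elim: n => [|n IH]; first by under eq_fun do rewrite expr0.
  by under eq_fun do rewrite exprS; exact: mM.
have m_id : cmeasurable (@of_pair R) by split; [exact: measurable_fst|exact: measurable_snd].
apply: mM; apply: mX => //; split; first exact: measurable_fst.
by apply: measurableT_comp => //; exact: measurable_snd.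
Qed.

Lemma Re_norm_monomial p q (z : R[i]) :
  complex.Re `|monomial p q z| = complex.Re `|z| ^+ (p + q).
Proof.
rewrite /monomial normrM !normrX norm_conjC -exprD normc_def.
by rewrite -rmorphXn.
Qed.

Lemma monomial_moment_fin p q :
  (\int[P0]_w (complex.Re `|monomial p q (xi w)|)%:E < +oo)%E.
Proof.
apply: le_lt_trans (xi_moments (p + q)); rewrite /abs_moment le_eqVlt; apply/orP; left.
by apply/eqP/eq_integral => w _; rewrite Re_norm_monomial.
Qed.

Lemma star_moment00 : star_moment 0 0 = 1.
Proof.
rewrite /star_moment (_ : (fun w => monomial 0 0 (xi w)) = fun _ => 1); last first.
  by apply/funext => w; rewrite /monomial mulr1.
rewrite /cexp /= Rintegral_cst0 /Rintegral integral_cst //.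
by rewrite [X in (_ * X)%E]probability_setT mule1.
Qed.

Lemma star_moment_conj p q : star_moment q p = (star_moment p q)^*.
Proof.
have [_ [_ iIm] _] := cexp_quadrant (P := P0) (cmeasurable_comp xi_rv (cmeasurable_monomial p q))
  (monomial_moment_fin p q).
rewrite /star_moment /cexp.
have conj w : monomial q p (xi w) = (monomial p q (xi w))^*.
  by rewrite /monomial rmorphM !rmorphXn /= conjCK mulrC.
have Im_conj (z : R[i]) : complex.Im z^* = -1 * complex.Im z by rewrite mulN1r; case: z.
have Re_conj (z : R[i]) : complex.Re z^* = complex.Re z by case: z.
under [in X in Complex X _]eq_Rintegral do rewrite conj Re_conj.
under [in X in Complex _ X]eq_Rintegral do rewrite conj Im_conj.
by rewrite RintegralZl // mulN1r.
Qed.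

Context d (T : measurableType d) (P : probability T R).

Lemma same_law_ge0 (Y : T -> R[i]) (h : R * R -> R) :
  complex_rv Y -> same_law P P0 Y xi -> measurable_fun setT h -> (forall y, 0 <= h y) ->
  (\int[P]_w (h (RIm (Y w)))%:E = \int[P0]_w (h (RIm (xi w)))%:E)%E.
Proof.
move=> mY lawY mh h0.
have ind d' (T' : measurableType d') (P' : probability T' R) (Z : T' -> R[i])
    (B : set (R * R)) : complex_rv Z -> measurable B ->
    weighted_integral P' (@RIm R \o Z) (fun _ => 1) \1_B = P' ((@RIm R \o Z) @^-1` B).
  move=> mZ mB; have mpre : measurable ((@RIm R \o Z) @^-1` B).
    by rewrite -[_ @^-1` _]setTI; exact: mZ.
  rewrite -[RHS]mul1e -[X in (_ * P' X)%E]setIT -integral_indic // mul1e.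
  by apply: eq_integral => w _; rewrite mulr1.
have := weighted_integral_ext (mu1 := P) (mu2 := P0) (Z1 := @RIm R \o Y)
  (Z2 := @RIm R \o xi) (W1 := fun _ => 1) (W2 := fun _ => 1).
move=> /(_ mY xi_rv (measurable_cst _) (measurable_cst _) (fun _ => ler01) (fun _ => ler01)).
move=> /(_ _ h mh h0) ext.
have : weighted_integral P (@RIm R \o Y) (fun _ => 1) h =
    weighted_integral P0 (@RIm R \o xi) (fun _ => 1) h.
  by apply: ext => B mB; rewrite !ind //; exact: lawY.
rewrite /weighted_integral; under eq_integral do rewrite mulr1.
by under [X in _ = X -> _]eq_integral do rewrite mulr1.
Qed.

Variables (V : finType) (X : V -> T -> R[i]).
Hypothesis X_rv : forall v, complex_rv (X v).
Hypothesis X_law : forall v, same_law P P0 (X v) xi.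
Hypothesis X_indep : mutually_independent P X.

Lemma copy_monomial v p q :
  (\int[P]_w (complex.Re `|monomial p q (X v w)|)%:E < +oo)%E /\
  cexp P (fun w => monomial p q (X v w)) = star_moment p q.
Proof.
have mm := cmeasurable_monomial p q.
have law (g : R[i] -> R) : measurable_fun setT (fun y => g (of_pair y)) -> (forall z, 0 <= g z) ->
    (\int[P]_w (g (X v w))%:E = \int[P0]_w (g (xi w))%:E)%E.
  move=> mg g0; have := same_law_ge0 (X_rv v) (X_law v) mg (fun y => g0 (of_pair y)).
  under eq_integral do rewrite of_pairK.
  by under [X in _ = X -> _]eq_integral do rewrite of_pairK.
have fin : (\int[P]_w (complex.Re `|monomial p q (X v w)|)%:E < +oo)%E.
  rewrite (law (fun z => complex.Re `|monomial p q z|)) ?monomial_moment_fin //.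
    exact: cmeasurable_norm mm.
  by move=> z; rewrite normc_def sqrtr_ge0.
split; rewrite ?fin // /star_moment.
have [_ _ ->] := cexp_quadrant (P := P) (cmeasurable_comp (X_rv v) mm) fin.
have [_ _ ->] := cexp_quadrant (P := P0) (cmeasurable_comp xi_rv mm) (monomial_moment_fin p q).
apply: eq_bigr => t _; congr (_ * (fine _)%:C%C).
apply: (law (fun z => quadrant t (monomial p q z))).
  exact: cmeasurable_quadrant t mm.
by move=> z; exact: quadrant_ge0.
Qed.

Definition letter_value (u : V * bool) (w : T) : R[i] :=
  if u.2 then (X u.1 w)^* else X u.1 w.

Lemma prod_letter_value (s : seq (V * bool)) w :
  \prod_(u <- s) letter_value u w =
  \prod_v monomial (count_mem (v, false) s) (count_mem (v, true) s) (X v w).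
Proof.
elim: s => [|[v b] s IH].
  by rewrite big_nil big1 // => v _; rewrite /monomial mulr1.
rewrite big_cons IH (bigD1 v) //= [RHS](bigD1 v) //= mulrA; congr (_ * _).
  rewrite /letter_value /monomial /= !xpair_eqE !eqxx /=; case: b => /=.
    by rewrite add0n add1n exprS mulrCA.
  by rewrite add0n add1n exprS mulrA.
by apply: eq_bigr => u uv; rewrite !xpair_eqE eq_sym (negPf uv).
Qed.

(** Collecting the factors of each variable leaves a product of independent
    monomials. *)
Theorem cexp_word (s : seq (V * bool)) :
  cintegrable P (fun w => \prod_(u <- s) letter_value u w) /\
  cexp P (fun w => \prod_(u <- s) letter_value u w) = mixed_moment star_moment s.
Proof.
have -> : (fun w => \prod_(u <- s) letter_value u w) =
    (fun w => \prod_v monomial (count_mem (v, false) s) (count_mem (v, true) s) (X v w)).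
  by apply/funext => w; exact: prod_letter_value.
pose f v := monomial (count_mem (v, false) s) (count_mem (v, true) s).
have [iX ->] := independent_cexp X_rv X_indep (f := f)
  (fun v => cmeasurable_monomial _ _) (fun v => (copy_monomial v _ _).1).
by split=> //; apply: eq_bigr => v _; exact: (copy_monomial v _ _).2.
Qed.

End IndependentCopies.

(** * Traces of words in convolution matrices *)

Section ConvolutionTrace.
Variables (R : realType) (G : finGroupType).
Implicit Types X Y : G -> R[i].

Lemma sum_enum_val (V : nmodType) (F : G -> V) :
  \sum_(k < #|G|) F (enum_val k) = \sum_x F x.
Proof.
rewrite [RHS](reindex_onto enum_val enum_rank) => [|x _]; last by rewrite enum_rankK.
by apply: eq_bigl => k; rewrite enum_valK eqxx.
Qed.

(** The regular representation turns convolution into the product of matrices. *)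
Lemma conv_mxM X Y :
  conv_mx X *m conv_mx Y = conv_mx (fun g => \sum_x X x * Y (x^-1 * g)%g).
Proof.
apply/matrixP => h g; rewrite !mxE.
under eq_bigr do rewrite !mxE.
rewrite (sum_enum_val (fun u => X (enum_val h * u^-1)%g * Y (u * (enum_val g)^-1)%g)).
rewrite [RHS](reindex_inj (inj_comp (mulgI (enum_val h)) invg_inj)) /=.
by apply: eq_bigr => u _; rewrite invMg invgK -!mulgA mulKg.
Qed.

Lemma conv_mx_adjoint X : (conv_mx X) ^t* = conv_mx (fun g => (X g^-1%g)^*).
Proof. by apply/matrixP => h g; rewrite !mxE invMg invgK. Qed.

Lemma conv_mx_delta : conv_mx (fun g => (g == 1%g)%:R) = 1%:M :> 'M[R[i]]_#|G|.
Proof.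
apply/matrixP => h g; rewrite !mxE -(inj_eq enum_val_inj).
rewrite -[in RHS](inj_eq (mulIg (enum_val g)^-1%g)).
by rewrite mulgV.
Qed.

Lemma mxtrace_conv X : \tr (conv_mx X) = #|G|%:R * X 1%g.
Proof.
rewrite /mxtrace (eq_bigr (fun _ => X 1%g)) => [|k _]; last by rewrite mxE mulgV.
by rewrite sumr_const card_ord mulr_natl.
Qed.

Lemma prod_conv_mx (L : Type) (w : seq L) (Y : L -> G -> R[i]) (r : R[i]) :
  \prod_(l <- w) (r *: conv_mx (Y l)) =
  r ^+ size w *: conv_mx (fun g => \sum_(a : (size w).-tuple G)
    ((\prod_(x <- a) x)%g == g)%:R * \prod_(u <- zip w a) Y u.1 u.2).
Proof.
elim: w => [|l w IH].
  rewrite big_nil expr0 scale1r -[1]/(1%:M) -conv_mx_delta; congr conv_mx.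
  apply/funext => g; rewrite (big_pred1 [tuple]) => [|a]; last first.
    by apply/esym/eqP/val_inj; case: a => [[]].
  by rewrite !big_nil mulr1 eq_sym.
rewrite big_cons IH -[_ * _]/(_ *m _) -scalemxAl -scalemxAr scalerA exprS conv_mxM.
congr (_ *: conv_mx _); apply/funext => g.
rewrite (big_tuple_cons _ (fun a => ((\prod_(x <- a) x)%g == g)%:R *
  \prod_(u <- zip (l :: w) a) Y u.1 u.2)) /=.
apply: eq_bigr => x _; rewrite mulr_sumr; apply: eq_bigr => a _.
rewrite !big_cons /= mulrCA; congr (_%:R * _).
by rewrite -(inj_eq (mulgI x)) mulKVg.
Qed.

End ConvolutionTrace.

Section MatrixModel.
Context d (T : measurableType d) (R : realType) (P : probability T R).
Variables (m : nat) (G : finGroupType) (X : 'I_m -> G -> T -> R[i]).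

Definition conv_model (v : 'I_m * bool) : random_mx R T #|G| := fun w =>
  let PX := conv_mx (fun g => X v.1 g w) in
  (sqrtC #|G|%:R)^-1 *: (if v.2 then PX ^t* else PX).

(** The normalized trace of the word, before the powers of |G|: paths in the
    product of matrices are parametrized by their successive quotients, which
    multiply to 1 when the path is closed. *)
Definition word_trace (s : seq ('I_m * bool)) (w : T) : R[i] :=
  \sum_(a : (size s).-tuple G) ((\prod_(x <- a) x)%g == 1%g)%:R *
    \prod_(u <- map (@variable_of _ G) (zip s a))
       letter_value (fun v : 'I_m * G => X v.1 v.2) u w.

Lemma random_mx_prod (s : seq ('I_m * bool)) w :
  (\prod_(v <- s) conv_model v) w = \prod_(v <- s) conv_model v w.
Proof. by elim: s => [|v s IH]; rewrite ?big_nil // !big_cons -IH. Qed.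

Lemma trace_word (s : seq ('I_m * bool)) w :
  \tr ((\prod_(v <- s) conv_model v) w) =
  #|G|%:R * (sqrtC #|G|%:R)^-1 ^+ size s * word_trace s w.
Proof.
pose Y (v : 'I_m * bool) g := if v.2 then (X v.1 g^-1%g w)^* else X v.1 g w.
rewrite random_mx_prod (eq_bigr (fun v => (sqrtC #|G|%:R)^-1 *: conv_mx (Y v))); last first.
  by move=> [j b] _; rewrite /conv_model /Y; case: b; rewrite //= conv_mx_adjoint.
rewrite prod_conv_mx mxtraceZ mxtrace_conv mulrCA mulrA; congr (_ * _).
apply: eq_bigr => a _; congr (_ * _); rewrite big_map; apply: eq_bigr => -[[j b] x] _.
by rewrite /Y /letter_value /=; case: b.
Qed.

Hypothesis word_int : forall s : seq (('I_m * G) * bool),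
  cintegrable P (fun w => \prod_(u <- s) letter_value (fun v => X v.1 v.2) u w).

Lemma cexp_word_trace s : cintegrable P (word_trace s) /\
  cexp P (word_trace s) = \sum_(a : (size s).-tuple G)
    ((\prod_(x <- a) x)%g == 1%g)%:R *
    cexp P (fun w => \prod_(u <- map (@variable_of _ G) (zip s a))
      letter_value (fun v => X v.1 v.2) u w).
Proof. exact: cexp_sum. Qed.

Lemma Etr_nceval (Q : ncpoly R ('I_m * bool)%type) :
  Etr P (nceval (@random_scalar_mx R T #|G|) conv_model Q) =
  \sum_(s <- finmap.enum_fset (monalg.msupp Q)) monalg.mcoeff s Q *
    ((sqrtC #|G|%:R)^-1 ^+ size s * cexp P (word_trace s)).
Proof.
have G0 : #|G|%:R != 0 :> R[i].
  by rewrite pnatr_eq0 -lt0n; apply/card_gt0P; exists 1%g.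
rewrite /Etr; have -> : (fun w => \tr (nceval (@random_scalar_mx R T #|G|) conv_model Q w)) =
   (fun w => \sum_(s <- finmap.enum_fset (monalg.msupp Q))
      (monalg.mcoeff s Q * (#|G|%:R * (sqrtC #|G|%:R)^-1 ^+ size s)) * word_trace s w).
  apply/funext => w; rewrite /nceval.
  elim: (finmap.enum_fset _) => [|s t IH]; first by rewrite !big_nil mxtrace0.
  rewrite !big_cons -IH mxtraceD; congr (_ + _).
  rewrite -[LHS]/(\tr ((monalg.mcoeff s Q)%:M *m (\prod_(v <- s) conv_model v) w)).
  by rewrite mul_scalar_mx mxtraceZ trace_word !mulrA.
have [_ ->] := cexp_sum (finmap.enum_fset (monalg.msupp Q))
  (fun s => monalg.mcoeff s Q * (#|G|%:R * (sqrtC #|G|%:R)^-1 ^+ size s))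
  (fun s => (cexp_word_trace s).1).
rewrite mulr_sumr; apply: eq_bigr => s _.
by rewrite mulrA mulrCA [_^-1 * _]mulrA mulVf // mul1r !mulrA.
Qed.

End MatrixModel.

(** * Convergence *)

Section RealBounds.
Variable R : realType.

(** Squeezing reduces the limit to a real one, where the order is total. *)
Lemma cvg_complex_le (f : nat -> R[i]) (l : R[i]) (b : nat -> R) :
  (forall N, `|f N - l| <= (b N)%:C%C) -> b @ \oo --> (0 : R) ->
  f @ \oo --> (l : R[i]^o).
Proof.
move=> f_le /cvgrPdist_lt b0; apply/(@cvgrPdist_lt _ R[i]^o) => e e0.
have [er e_im] : e = (complex.Re e)%:C%C /\ 0 < complex.Re e.
  by move: e0; rewrite ltcE /= => /andP[/eqP eI eR]; split=> //; case: e eI {eR} => x y /= ->.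
have := b0 _ e_im; apply: filterS => N; rewrite sub0r normrN => bN.
rewrite distrC er; apply: le_lt_trans (f_le N) _; rewrite ltcR.
exact: le_lt_trans (ler_norm _) bN.
Qed.

Lemma inv_sqrt_card_vanish (gT : nat -> finGroupType) :
  (fun N => #|gT N|) @ \oo --> \oo ->
  (fun N => (Num.sqrt #|gT N|%:R)^-1 : R) @ \oo --> (0 : R).
Proof.
move=> card_gT; rewrite -[X in _ --> X]sqrtr0.
under eq_fun do rewrite -sqrtrV //.
apply: (@cvg_comp _ _ _ (fun N => #|gT N|%:R^-1 : R) Num.sqrt); last exact: sqrt_continuous.
have card_R : (#|gT N|%:R : R) @[N --> \oo] --> +oo.
  exact: (@cvg_comp _ _ _ (fun N => #|gT N|) (fun n => n%:R : R) _ _ _ card_gT (@cvgr_idn R)).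
apply: (gtr0_cvgV0 _).2 card_R.
by apply: nearW => N; rewrite ltr0n; apply/card_gt0P; exists 1%g.
Qed.

End RealBounds.

(** Both error terms of [moment_estimate] vanish: the first because the groups
    grow, the second by [commuting_pairs_vanish]. *)
Lemma word_trace_cvg (R : realType)
  (gT : nat -> finGroupType)
  (card_gT : (fun N => #|gT N|) @ \oo --> \oo)
  (plancherel_gT : weak_cvg (fun N => plancherel_dim R (gT N))
                            (dirac (None : Borel Zbar)))
  (d0 : measure_display) (T0 : measurableType d0) (P0 : probability T0 R)
  (xi : T0 -> R[i])
  (xi_rv : complex_rv xi)
  (xi_moments : forall k, (abs_moment P0 xi k < +oo)%E)
  (E_xi : cexp P0 xi = 0)
  (E_xi2 : cexp P0 (fun w => xi w ^+ 2) = 0)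
  (E_absxi2 : cexp P0 (fun w => `|xi w| ^+ 2) = 1)
  (m : nat) (s : seq ('I_m * bool)) :
  (fun N => (sqrtC #|gT N|%:R)^-1 ^+ size s *
     \sum_(a : (size s).-tuple (gT N)) ((\prod_(x <- a) x)%g == 1%g)%:R *
       mixed_moment (star_moment P0 xi) (map (@variable_of _ (gT N)) (zip s a)))
  @ \oo --> (fock (@circular_kernel R[i] _) s [::] : R[i]^o).
Proof.
pose mom := star_moment P0 xi; pose n := size s.
have mom00 : mom 0%N 0%N = 1 by exact: star_moment00.
have mom_conj p q : mom q p = (mom p q)^* by exact: star_moment_conj.
have mom10 : mom 1%N 0%N = 0.
  by rewrite -E_xi /mom /star_moment /monomial; congr cexp; apply/funext => w; rewrite mulr1.
have mom20 : mom 2%N 0%N = 0.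
  by rewrite -E_xi2 /mom /star_moment /monomial; congr cexp; apply/funext => w; rewrite mulr1.
have mom01 : mom 0%N 1%N = 0 by rewrite mom_conj mom10 rmorph0.
have mom02 : mom 0%N 2%N = 0 by rewrite mom_conj mom20 rmorph0.
have mom11 : mom 1%N 1%N = 1.
  by rewrite -E_absxi2 /mom /star_moment /monomial; congr cexp; apply/funext => w; rewrite normCK.
pose M : R[i] := 1 + \sum_(p < n.+1) \sum_(q < n.+1) `|mom p q|.
have M1 : 1 <= M by rewrite lerDl sumr_ge0 // => p _; apply: sumr_ge0.
have momM p q : (p <= n)%N -> (q <= n)%N -> `|mom p q| <= M.
  move=> pn qn; rewrite /M (bigD1 (Ordinal (pn : (p < n.+1)%N))) //=.
  rewrite (bigD1 (Ordinal (qn : (q < n.+1)%N))) //= addrCA -addrA lerDl.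
  rewrite !addr_ge0 ?ler01 ?sumr_ge0 // => p' _; exact: sumr_ge0.
pose C1 : R[i] := (n ^ n)%:R * (M ^+ n + pair_sum false (fun _ _ => 1) s [::]).
pose C2 : R[i] := pair_sum false (@circular_kernel R[i] _) s [::].
have C1_real : C1 = (complex.Re C1)%:C%C.
  have : 0 <= C1.
    by rewrite mulr_ge0 // addr_ge0 ?exprn_ge0 ?(le_trans ler01 M1) // pair_sum_ge0.
  by case: C1 => x y; rewrite lecE /= => /andP[/eqP -> _].
have C2_real : C2 = (complex.Re C2)%:C%C.
  have : 0 <= C2 by apply: pair_sum_ge0.
  by case: C2 => x y; rewrite lecE /= => /andP[/eqP -> _].
apply: (@cvg_complex_le _ _ _ (fun N => complex.Re C1 * (Num.sqrt #|gT N|%:R)^-1 +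
  (commuting_pairs (gT N))%:R / #|gT N|%:R ^+ 2 * complex.Re C2)); last first.
  rewrite -[X in _ --> X]addr0 -[X in _ --> X + _](mulr0 (complex.Re C1)).
  rewrite -[X in _ --> _ + X](mul0r (complex.Re C2)).
  apply: cvgD; first by apply: cvgM; [exact: cvg_cst|exact: inv_sqrt_card_vanish].
  by apply: cvgM; [exact: commuting_pairs_vanish|exact: cvg_cst].
move=> N; pose r : R[i] := (Num.sqrt #|gT N|%:R)%:C%C.
have r_ge0 : 0 <= r by rewrite ler0c sqrtr_ge0.
have r2 : r ^+ 2 = #|gT N|%:R by rewrite -rmorphXn /= sqr_sqrtr // rmorph_nat.
have -> : sqrtC #|gT N|%:R = r by rewrite -r2 sqrCK.
rewrite exprVn.
have := moment_estimate mom00 mom10 mom01 mom20 mom02 mom11 M1 momM r_ge0 r2.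
move=> /le_trans; apply.
rewrite -/C1 -/C2 le_eqVlt; apply/orP; left; apply/eqP.
rewrite {1}C1_real {1}C2_real /r.
by rewrite rmorphD !rmorphM /= !fmorphV /= rmorphXn /= !rmorph_nat.
Qed.

Theorem theorem5p5 (R : realType)
  (gT : nat -> finGroupType)
  (card_gT : (fun N => #|gT N|) @ \oo --> \oo)
  (plancherel_gT : weak_cvg (fun N => plancherel_dim R (gT N))
                            (dirac (None : Borel Zbar)))
  (d0 : measure_display) (T0 : measurableType d0) (P0 : probability T0 R)
  (xi : T0 -> R[i])
  (xi_rv : complex_rv xi)
  (xi_moments : forall k, (abs_moment P0 xi k < +oo)%E)
  (E_xi : cexp P0 xi = 0)
  (E_xi2 : cexp P0 (fun w => xi w ^+ 2) = 0)
  (E_absxi2 : cexp P0 (fun w => `|xi w| ^+ 2) = 1)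
  (m : nat) (m_gt0 : (0 < m)%N)
  (d : nat -> measure_display) (T : forall N, measurableType (d N))
  (P : forall N, probability (T N) R)
  (X : forall N, 'I_m -> gT N -> T N -> R[i])
  (X_rv : forall N j g, complex_rv (X N j g))
  (X_law : forall N j g, same_law (P N) P0 (X N j g) xi)
  (X_indep : forall N,
     mutually_independent (P N) (fun jg : 'I_m * gT N => X N jg.1 jg.2))
  (A : cstarAlgType R) (phi : {scalar A}) (phi_state : is_state phi)
  (c : 'I_m -> A)
  (c_circular : forall j, circular phi (c j))
  (c_free : free_sets phi (fun j => [set c j; star (c j)])) :
  cvg_in_moments (fun N => @random_scalar_mx R (T N) #|gT N|)
    (fun N M => Etr (P N) M)
    (fun N (v : 'I_m * bool) w =>
       let PX := conv_mx (fun g => X N v.1 g w) in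
       (sqrtC #|gT N|%:R)^-1 *: (if v.2 then PX ^t* else PX))
    phi
    (fun v : 'I_m * bool => if v.2 then star (c v.1) else c v.1).
Proof.
move=> Q.
have word N (s : seq (('I_m * gT N) * bool)) :=
  cexp_word xi_rv xi_moments (X := fun v : 'I_m * gT N => X N v.1 v.2)
    (fun v => X_rv N v.1 v.2) (fun v => X_law N v.1 v.2) (X_indep N) s.
have -> : (fun N => Etr (P N) (nceval (@random_scalar_mx R (T N) #|gT N|)
      (fun (v : 'I_m * bool) w =>
       let PX := conv_mx (fun g => X N v.1 g w) in
       (sqrtC #|gT N|%:R)^-1 *: (if v.2 then PX ^t* else PX)) Q)) =
    (fun N => \sum_(s <- finmap.enum_fset (monalg.msupp Q)) monalg.mcoeff s Q *
      ((sqrtC #|gT N|%:R)^-1 ^+ size s *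
       \sum_(a : (size s).-tuple (gT N)) ((\prod_(x <- a) x)%g == 1%g)%:R *
         mixed_moment (star_moment P0 xi) (map (@variable_of _ (gT N)) (zip s a)))).
  apply/funext => N; rewrite -/(conv_model (X N)) Etr_nceval; last by move=> s; case: (word N s).
  apply: eq_bigr => s _; congr (_ * (_ * _)).
  have [_ ->] := cexp_word_trace (P := P N) (X := X N) (fun s => (word N s).1) s.
  by apply: eq_bigr => a _; rewrite (word N _).2.
have -> : phi (nceval (in_alg A) (fun v : 'I_m * bool => if v.2 then star (c v.1) else c v.1) Q) =
    \sum_(s <- finmap.enum_fset (monalg.msupp Q)) monalg.mcoeff s Q *
      fock (@circular_kernel R[i] _) s [::].
  rewrite /nceval linear_sum; apply: eq_bigr => s _.
  by rewrite mulr_algl linearZ /= (free_circular_moment phi_state.1).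
elim: (finmap.enum_fset (monalg.msupp Q)) => [|s t IH].
  by rewrite big_nil; under eq_fun do rewrite big_nil; exact: (@cvg_cst R[i]^o).
rewrite big_cons; under eq_fun do rewrite big_cons.
have cvg_s := @word_trace_cvg _ _ card_gT plancherel_gT _ _ _ _ xi_rv xi_moments
  E_xi E_xi2 E_absxi2 m s.
apply: (@cvgD R[i] R[i]^o) IH.
exact: (@cvgZ R[i] R[i]^o _ _ _ _ _ _ _ (cvg_cst _) cvg_s).
Qed.
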